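(* Let $n\ge1$ and consider the expansion of $(2n)!\,A_n$ in the basis $\{h_\lambda\}$. Then: (a) the coefficient of $h_1^n$ is $1$; (b) the sum of all the coefficients is $E_{2n}$; (c) the coefficient of $h_n$ is $nE_{2n-1}$, which equals the number of cyclically alternating permutations of $[2n]$, i.e. $w=a_1\cdots a_{2n}\in\mathfrak{S}_{2n}$ with $a_1>a_2<a_3>\cdots>a_{2n}$ and $a_{2n}<a_1$; (d) writing $E'_{2m}=mE_{2m-1}$, for $i,j\ge1$ with $i+j=n$, $$[h_ih_j](2n)!A_n=\begin{cases}\binom{2n}{2i}E'_{2i}E'_{2j}-E'_{2n}, & i\ne j,\\[0.3em] \frac12\left(\binom{2n}{n}(E'_n)^2-E'_{2n}\right), & i=j=n/2.\end{cases}$$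
   Context: $A_n=\frac{1}{(2n)!}\sum_{\lambda\vdash n}|\phi(\lambda)|\,p_\lambda$, where for $\lambda=\langle 1^{m_1},\dots,n^{m_n}\rangle\vdash n$ ($m_k$ parts equal to $k$), $\phi(\lambda)=(2n)!\prod_{k=1}^n\frac{1}{m_k!}\left(\frac{4^k(4^k-1)B_{2k}}{(2k)(2k)!}\right)^{m_k}$ with $B_{2k}$ Bernoulli numbers, and $p_\lambda$ power sums. Euler numbers $E_k$ are defined by $\sec t+\tan t=\sum_{k\ge0}E_k\frac{t^k}{k!}$. $[h_\mu]f$ is the coefficient of $h_\mu$ in $f$; $h_1^n=h_{(1,\dots,1)}$. *)

(* Defs.v *)
From HB Require Import structures.
From mathcomp Require Import all_boot all_order all_fingroup all_algebra.
From mathcomp Require Import finmap.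
From mathcomp.multinomials Require Import mpoly.

Set Implicit Arguments.
Unset Strict Implicit.
Unset Printing Implicit Defensive.

Import Order.TTheory GRing.Theory Num.Theory.
Local Open Scope ring_scope.

(* A formal power series over the rationals is its sequence of coefficients. *)
Definition fps := nat -> rat.

Definition fps_mul (f g : fps) : fps :=
  fun m => \sum_(i < m.+1) f i * g (m - i)%N.

(* The first m coefficients of 1 / f, obtained by solving f * (1 / f) = 1. *)
Fixpoint fps_inv_seq (f : fps) (m : nat) : seq rat :=
  if m is m'.+1 then
    let s := fps_inv_seq f m' in
    rcons s (((m' == 0%N)%:R - \sum_(i < m') f (m' - i)%N * s`_i) / f 0%N)
  else [::].

Definition fps_inv (f : fps) : fps := fun m => (fps_inv_seq f m.+1)`_m.

Lemma size_fps_inv_seq f m : size (fps_inv_seq f m) = m.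
Proof. by elim: m => //= m IHm; rewrite size_rcons IHm. Qed.

Lemma nth_fps_inv_seq f m i : (i < m)%N -> (fps_inv_seq f m)`_i = fps_inv f i.
Proof.
elim: m => // m IHm; rewrite ltnS leq_eqVlt => /orP[/eqP -> //|lt_im].
by rewrite /= nth_rcons size_fps_inv_seq lt_im IHm.
Qed.

Lemma fps_mulV (f : fps) m :
  f 0%N != 0 -> fps_mul f (fps_inv f) m = (m == 0%N)%:R.
Proof.
move=> f0; rewrite /fps_mul (reindex_inj rev_ord_inj) big_ord_recr /=.
rewrite !subSS subnn subn0 {2}/fps_inv /= nth_rcons size_fps_inv_seq ltnn eqxx.
rewrite [f 0%N * _]mulrC divfK // addrC.
rewrite [X in _ + X](_ : _ = \sum_(i < m) f (m - i)%N * (fps_inv_seq f m)`_i).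
  by rewrite subrK.
apply: eq_bigr => i _; rewrite subSS subKn; last exact: ltnW.
by rewrite nth_fps_inv_seq.
Qed.

Definition fps_cos : fps :=
  fun k => if odd k then 0 else (-1) ^+ k./2 / k`!%:R.

Definition fps_sin : fps :=
  fun k => if odd k then (-1) ^+ k./2 / k`!%:R else 0.

Definition fps_sec : fps := fps_inv fps_cos.

Definition fps_tan : fps := fps_mul fps_sin fps_sec.

Definition euler (k : nat) : rat := k`!%:R * (fps_sec k + fps_tan k).

(* E'_{2m} = m E_{2m-1}; only meaningful at even k. *)
Definition euler' (k : nat) : rat := (k./2)%:R * euler k.-1.

(* t / (e^t - 1), as the inverse of (e^t - 1) / t = \sum_k t^k / (k+1)!. *)
Definition bernoulli (k : nat) : rat :=
  k`!%:R * fps_inv (fun j => (j.+1)`!%:R^-1) k.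

Record intpart := IntPart
  { parts :> seq nat; _ : sorted geq parts && (0%N \notin parts) }.

HB.instance Definition _ := [isSub for parts].
HB.instance Definition _ := [Choice of intpart by <:].

Lemma mkpart_subproof (s : seq nat) :
  let t := sort geq (filter (leq 1) s) in sorted geq t && (0%N \notin t).
Proof.
by rewrite /= sort_sorted ?mem_sort ?mem_filter // => x y; apply: leq_total.
Qed.

(* The partition whose parts are the nonzero entries of s. *)
Definition mkpart (s : seq nat) : intpart := IntPart (mkpart_subproof s).

(* Partitions of m, listed without repetition: those with at most m parts,
   all at most m, and of sum m (see mem_partitions). *)
Definition partitions (m : nat) : seq intpart :=
  undup [seq mkpart [seq val x | x <- tval t]
        | t <- enum {: m.-tuple 'I_m.+1} & sumn [seq val x | x <- tval t] == m].

Lemma mkpartK (l : intpart) (k : nat) : mkpart (parts l ++ nseq k 0%N) = l.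
Proof.
apply: val_inj => /=; rewrite filter_cat.
have -> : [seq x <- nseq k 0%N | (1 <= x)%N] = [::] by elim: k.
case: l => s /= /andP[s_sorted s0]; rewrite cats0.
have /all_filterP -> : all (leq 1) s.
  by apply/allP => x xs; rewrite lt0n; apply: contraNneq s0 => <-.
by apply: (sorted_sort _ s_sorted) => x y z yx xz; apply: leq_trans xz yx.
Qed.

Lemma sumn_mkpart s : sumn (mkpart s) = sumn s.
Proof.
rewrite /= (perm_sumn (permEl (perm_sort _ _))).
by elim: s => //= -[|x] s /= ->.
Qed.

Lemma leq_mem_sumn (s : seq nat) x : x \in s -> (x <= sumn s)%N.
Proof.
elim: s => //= y s IHs; rewrite inE => /orP[/eqP ->|/IHs]; first exact: leq_addr.
by move/leq_trans; apply; apply: leq_addl.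
Qed.

Lemma size_intpart (l : intpart) : (size l <= sumn l)%N.
Proof.
case: l => s /= /andP[_]; elim: s => //= x s IHs.
rewrite inE negb_or => /andP[x0 /IHs]; move: x0; case: x => // x _ le_s.
by rewrite addSn ltnS (leq_trans le_s) ?leq_addl.
Qed.

Lemma mem_partitions m (l : intpart) : (l \in partitions m) = (sumn l == m).
Proof.
rewrite mem_undup; apply/mapP/idP => [[t]|/eqP sum_l].
  by rewrite mem_filter => /andP[sum_t _] ->; rewrite sumn_mkpart.
have le_m : (size l <= m)%N by rewrite -sum_l size_intpart.
pose s := parts l ++ nseq (m - size l) 0%N.
have sz_s : size (map (@inord m) s) == m.
  by rewrite size_map size_cat size_nseq subnKC.
have val_s : [seq val x | x <- map (@inord m) s] = s.
  rewrite -map_comp -[RHS]map_id; apply/eq_in_map => x xs /=.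
  rewrite inordK // ltnS; move: xs; rewrite mem_cat => /orP[/leq_mem_sumn|].
    by rewrite sum_l.
  by rewrite mem_nseq => /andP[_ /eqP ->].
exists (Tuple sz_s); last by rewrite /= val_s mkpartK.
rewrite mem_filter mem_enum andbT /= val_s sumn_cat sumn_nseq mul0n addn0.
exact/eqP.
Qed.

(* A symmetric function is given by the sequence of its restrictions to
   finitely many variables x_1, ..., x_N, for all N. *)
Definition symfun := forall N : nat, {mpoly rat[N]}.

Definition sym_p (k : nat) : symfun := fun N => \sum_(i < N) 'X_i ^+ k.

Definition sym_h (k : nat) : symfun :=
  fun N => \sum_(m : 'X_{1..N < k.+1} | mdeg m == k) 'X_[m].

Definition sym_p_part (l : intpart) : symfun :=
  fun N => \prod_(k <- parts l) sym_p k N.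

Definition sym_h_part (l : intpart) : symfun :=
  fun N => \prod_(k <- parts l) sym_h k N.

Definition scale_symfun (a : rat) (f : symfun) : symfun := fun N => a *: f N.

(* The multiplicity m_k of k in l is count_mem k l. *)
Definition phi (l : intpart) : rat :=
  let n := sumn l in
  (2 * n)`!%:R *
  \prod_(1 <= k < n.+1)
    ((count_mem k l)`!%:R^-1 *
     ((4 ^+ k * (4 ^+ k - 1) * bernoulli (2 * k))
        / ((2 * k)%:R * (2 * k)`!%:R)) ^+ count_mem k l).

Definition symA (n : nat) : symfun :=
  fun N => (2 * n)`!%:R^-1 *:
    \sum_(l <- partitions n) `|phi l| *: sym_p_part l N.

(* c is the finitely supported family of coefficients of f on the h_lambda,
   lambda ranging over all integer partitions. *)
Definition h_expansion (f : symfun) (c : {fsfun intpart -> rat with 0}) : Prop :=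
  forall N, f N = \sum_(l <- finsupp c) c l *: sym_h_part l N.

(* The one-line notation of w is a_{i+1} = w i, with values shifted to start
   from 0.  As ordS is the cyclic successor, i = 2n - 1 gives a_{2n} < a_1. *)
Definition cyc_alternating (n : nat) (w : 'S_(2 * n)) : bool :=
  [forall i : 'I_(2 * n), if odd i then (w i < w (ordS i))%N else (w (ordS i) < w i)%N].

(* Main.v *)
Require Import Defs.
From HB Require Import structures.
From mathcomp Require Import all_boot all_order all_fingroup all_algebra all_field.
From mathcomp Require Import finmap boolp.
From mathcomp.multinomials Require Import mpoly.
From mathcomp Require Import ring lra zify.

Set Implicit Arguments.
Unset Strict Implicit.
Unset Printing Implicit Defensive.

Import Order.TTheory GRing.Theory Num.Theory.
Local Open Scope ring_scope.

(** Formally, [cos (sqrt u) = \prod_j (1 - y_j u)], so that [\sum_n A_n u^n],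
    which is [exp (\sum_k |c_k| p_k(x) u^k) = \prod_i sec (sqrt (x_i u))], equals
    [\prod_(i, j) (1 - x_i y_j u)^-1].  By Cauchy's identity the coefficient of
    [h_lambda] in [A_n] is therefore the monomial symmetric function
    [m_lambda(y)], where [e_k(y) = 1 / (2k)!], [h_k(y) = E_2k / (2k)!] and
    [p_k(y) = E_(2k-1) / (2 (2k-1)!)]; the four claims are
    [m_(1^n) = e_n], [\sum_lambda m_lambda = h_n], [m_(n) = p_n] and
    [m_(i,j) = p_i p_j - p_n] (halved if [i = j]).

    Only degrees up to [n] matter, so the [y_j] can be taken to be the [n] inverse
    roots in [algC] of the truncation of [cos (sqrt u)]; [m_lambda(y)] is rational
    because it is symmetric.  Identities between generating functions are proved
    by comparing logarithmic derivatives.  The expansion is unique because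
    inverse roots can be chosen to give [h_1, ..., h_n] arbitrary values. *)

(** * Formal power series *)

(** A name of its own for sequences, so that convolution can be declared as their ring product. The
    equality and choice structures are the classical ones. *)
Definition series (R : Type) := nat -> R.

HB.instance Definition _ (R : Type) := gen_eqMixin (series R).
HB.instance Definition _ (R : Type) := gen_choiceMixin (series R).

Section SeriesRing.
Variable R : comNzRingType.
Implicit Types f g h : series R.

Lemma seriesP f g : (forall n, f n = g n) -> f = g.
Proof. by move=> fg; apply: funext. Qed.

Definition ser_zero : series R := fun=> 0.
Definition ser_opp f : series R := fun n => - f n.
Definition ser_add f g : series R := fun n => f n + g n.
Definition ser_one : series R := fun n => (n == 0%N)%:R.
Definition ser_mul f g : series R := fun n => \sum_(i < n.+1) f i * g (n - i)%N.

Fact ser_addA : associative ser_add.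
Proof. by move=> f g h; apply: seriesP => n; apply: addrA. Qed.
Fact ser_addC : commutative ser_add.
Proof. by move=> f g; apply: seriesP => n; apply: addrC. Qed.
Fact ser_add0 : left_id ser_zero ser_add.
Proof. by move=> f; apply: seriesP => n; apply: add0r. Qed.
Fact ser_addN : left_inverse ser_zero ser_opp ser_add.
Proof. by move=> f; apply: seriesP => n; apply: addNr. Qed.

HB.instance Definition _ :=
  GRing.isZmodule.Build (series R) ser_addA ser_addC ser_add0 ser_addN.

Definition trunc_poly n f : {poly R} := \poly_(i < n.+1) f i.

Lemma coef_trunc_poly n f i : (i <= n)%N -> (trunc_poly n f)`_i = f i.
Proof. by move=> le_in; rewrite coef_poly ltnS le_in. Qed.

(* Multiplication of series is that of polynomials up to any given degree, so
   the ring axioms are inherited from [{poly R}]. *)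
Fact ser_mulE n f g i : (i <= n)%N ->
  ser_mul f g i = (trunc_poly n f * trunc_poly n g)`_i.
Proof.
move=> le_in; rewrite coefM; apply: eq_bigr => j _.
have le_ji : (j <= i)%N by rewrite -ltnS.
by rewrite !coef_trunc_poly // ?(leq_trans (leq_subr _ _)) // (leq_trans le_ji).
Qed.

Fact eq_coefM n (p p' q q' : {poly R}) :
  (forall i, (i <= n)%N -> p`_i = p'`_i) ->
  (forall i, (i <= n)%N -> q`_i = q'`_i) ->
  forall i, (i <= n)%N -> (p * q)`_i = (p' * q')`_i.
Proof.
move=> pp' qq' i le_in; rewrite !coefM; apply: eq_bigr => j _.
have le_ji : (j <= i)%N by rewrite -ltnS.
by rewrite pp' ?qq' // ?(leq_trans (leq_subr _ _)) // (leq_trans le_ji).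
Qed.

Fact coef_trunc_mul n f g i : (i <= n)%N ->
  (trunc_poly n (ser_mul f g))`_i = (trunc_poly n f * trunc_poly n g)`_i.
Proof. by move=> le_in; rewrite coef_trunc_poly // -ser_mulE. Qed.

Fact ser_mulA : associative ser_mul.
Proof.
move=> f g h; apply: seriesP => n; rewrite !(@ser_mulE n) //.
rewrite (@eq_coefM n _ (trunc_poly n f) _ (trunc_poly n g * trunc_poly n h)) //.
  rewrite mulrA; apply: (@eq_coefM n) => // i le_in.
  by rewrite coef_trunc_mul.
exact: coef_trunc_mul.
Qed.
Fact ser_mulC : commutative ser_mul.
Proof. by move=> f g; apply: seriesP => n; rewrite !(@ser_mulE n) // mulrC. Qed.
Fact ser_mul1 : left_id ser_one ser_mul.
Proof.
move=> f; apply: seriesP => n; rewrite /ser_mul big_ord_recl /= subn0 mul1r.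
by rewrite big1 ?addr0 // => i _; rewrite mul0r.
Qed.
Fact ser_mulDl : left_distributive ser_mul ser_add.
Proof.
move=> f g h; apply: seriesP => n; rewrite /ser_mul /ser_add -big_split /=.
by apply: eq_bigr => i _; rewrite mulrDl.
Qed.
Fact ser_one_neq0 : ser_one != 0.
Proof.
apply/eqP => /(congr1 (fun f : series R => f 0%N)).
by move/eqP; rewrite oner_eq0.
Qed.

HB.instance Definition _ :=
  GRing.Zmodule_isComNzRing.Build (series R)
    ser_mulA ser_mulC ser_mul1 ser_mulDl ser_one_neq0.

Lemma ser0E n : (0 : series R) n = 0. Proof. by []. Qed.
Lemma ser1E n : (1 : series R) n = (n == 0%N)%:R. Proof. by []. Qed.
Lemma serDE f g n : (f + g) n = f n + g n. Proof. by []. Qed.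
Lemma serNE f n : (- f) n = - f n. Proof. by []. Qed.
Lemma serBE f g n : (f - g) n = f n - g n. Proof. by []. Qed.
Lemma serME f g n : (f * g) n = \sum_(i < n.+1) f i * g (n - i)%N.
Proof. by []. Qed.
Lemma ser_sumE I (r : seq I) (P : pred I) (F : I -> series R) n :
  (\sum_(i <- r | P i) F i) n = \sum_(i <- r | P i) F i n.
Proof. exact: (big_morph (fun f : series R => f n)). Qed.

Lemma serM0E f g : (f * g) 0%N = f 0%N * g 0%N.
Proof. by rewrite serME big_ord_recl big_ord0 addr0. Qed.

Lemma ser_prod0E I (r : seq I) (P : pred I) (F : I -> series R) :
  (\prod_(i <- r | P i) F i) 0%N = \prod_(i <- r | P i) F i 0%N.
Proof. exact: (big_morph (fun f : series R => f 0%N) serM0E). Qed.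

Definition eqtrunc n f g := forall i, (i <= n)%N -> f i = g i.

Lemma eqtruncM n f f' g g' :
  eqtrunc n f f' -> eqtrunc n g g' -> eqtrunc n (f * g) (f' * g').
Proof.
move=> ff' gg' i le_in; rewrite !serME; apply: eq_bigr => j _.
have le_ji : (j <= i)%N by rewrite -ltnS.
by rewrite ff' ?gg' // ?(leq_trans (leq_subr _ _)) // (leq_trans le_ji).
Qed.

(** Since [f' = f' * g * g'] and [g' = f' * f * g'], the two inverses differ only by exchanging [f]
    and [g] inside a product. *)
Lemma eqtrunc_inv n f f' g g' :
  f * f' = 1 -> g * g' = 1 -> eqtrunc n f g -> eqtrunc n f' g'.
Proof.
move=> ff' gg' fg i le_in.
have -> : f' = f' * g * g' by rewrite -mulrA gg' mulr1.
have {2}-> : g' = f' * f * g' by rewrite [f' * f]mulrC ff' mul1r.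
apply: (@eqtruncM n) => // j le_jn.
by apply: (@eqtruncM n) => // k le_kn; rewrite fg.
Qed.

Definition poly_ser (p : {poly R}) : series R := fun i => p`_i.

Lemma poly_serM : {morph poly_ser : p q / p * q}.
Proof. by move=> p q; apply: seriesP => n; rewrite serME /poly_ser coefM. Qed.
Lemma poly_ser1 : poly_ser 1 = 1.
Proof. by apply: seriesP => n; rewrite /poly_ser coef1. Qed.

(** Only the terms of degree at most [m] in each factor matter, so the factors can be replaced by
    polynomials and a finite product of finite sums expanded. *)
Lemma ser_prodE (r m : nat) (F : 'I_r -> series R) :
  (\prod_j F j) m =
  \sum_(f : {ffun 'I_r -> 'I_m.+1} | (\sum_j f j)%N == m) \prod_j F j (f j).
Proof.
have -> : (\prod_j F j) m = (\prod_j trunc_poly m (F j))`_m.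
  rewrite -[RHS]/(poly_ser _ m) (big_morph _ poly_serM poly_ser1).
  pose K f g := eqtrunc m f g.
  apply: (big_ind2 K) => // [f f' g g'|j _ i le_im]; first exact: eqtruncM.
  by rewrite /poly_ser coef_trunc_poly.
under eq_bigr do rewrite /trunc_poly poly_def.
rewrite bigA_distr_bigA coef_sum [RHS]big_mkcond /=; apply: eq_bigr => f _.
have -> : \prod_i (F i (f i) *: 'X^(f i)) =
          (\prod_i F i (f i)) *: 'X^(\sum_i f i) :> {poly R}.
  elim/big_rec3: _ => [|i a b c _ ->]; first by rewrite scale1r expr0.
  by rewrite exprD -scalerAl -scalerAr scalerA.
by rewrite coefZ coefXn eq_sym; case: eqP; rewrite ?mulr1 ?mulr0.
Qed.

(** The Euler operator [t d/dt]: a derivation like [d/dt], but without a shift of indices. *)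
Definition sD f : series R := fun n => n%:R * f n.

Lemma sDM f g : sD (f * g) = sD f * g + f * sD g.
Proof.
apply: seriesP => n; rewrite serDE /sD !serME mulr_sumr -big_split /=.
apply: eq_bigr => i _.
have -> : n%:R = i%:R + (n - i)%:R :> R by rewrite -natrD subnKC // -ltnS.
by ring.
Qed.
Lemma sD1 : sD 1 = 0.
Proof. by apply: seriesP => -[|n]; rewrite /sD ?mul0r ?mulr0. Qed.

Lemma sD_prod I (r : seq I) (P : pred I) (F A : I -> series R) :
  (forall i, sD (F i) = A i * F i) ->
  sD (\prod_(i <- r | P i) F i) =
    (\sum_(i <- r | P i) A i) * \prod_(i <- r | P i) F i.
Proof.
move=> FA; elim/big_rec2: _ => [|i a f _ IH]; first by rewrite sD1 mul0r.
by rewrite sDM IH FA; ring.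
Qed.

Definition geo (z : R) : series R := fun n => z ^+ n.
(** This is [z t / (1 - z t)], the logarithmic derivative under [sD] of [geo z], that is, of
    [1 / (1 - z t)]. *)
Definition powers (z : R) : series R := fun n => if n is 0%N then 0 else z ^+ n.
Definition lin (z : R) : series R := fun n =>
  match n with 0%N => 1 | 1%N => - z | _ => 0 end.

Lemma serM_linE z f n : (lin z * f) n.+1 = f n.+1 - z * f n.
Proof.
rewrite serME big_ord_recl big_ord_recl /= big1 => [|i _]; last by rewrite mul0r.
by rewrite mul1r subn0 addr0 subSS subn0 mulNr.
Qed.

Lemma lin_geo z : lin z * geo z = 1.
Proof.
apply: seriesP => -[|n]; first by rewrite serM0E mulr1.
by rewrite serM_linE /geo exprS subrr.
Qed.

Lemma sD_lin z : sD (lin z) = - powers z * lin z.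
Proof.
apply: seriesP => -[|n]; first by rewrite /sD mul0r serM0E serNE oppr0 mul0r.
rewrite mulNr serNE mulrC serM_linE /sD.
by case: n => [|n] /=; rewrite ?exprS; ring.
Qed.

(** Apply the derivation to [lin z * geo z = 1] and multiply the result by [geo z]. *)
Lemma sD_geo z : sD (geo z) = powers z * geo z.
Proof.
apply/eqP; rewrite -subr_eq0; apply/eqP.
have E : sD (lin z * geo z) = 0 by rewrite lin_geo sD1.
rewrite sDM sD_lin in E.
transitivity ((lin z * geo z) * (sD (geo z) - powers z * geo z)).
  by rewrite lin_geo mul1r.
transitivity (geo z * (- powers z * lin z * geo z + lin z * sD (geo z))).
  by ring.
by rewrite E mulr0.
Qed.
End SeriesRing.

(** * Secant, tangent and Bernoulli numbers *)

Lemma fact_neq0 m : m`!%:R != 0 :> rat.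
Proof. by rewrite pnatr_eq0 -lt0n fact_gt0. Qed.

Lemma sum_even_terms (V : nmodType) (F : nat -> V) k :
  (forall i, odd i -> F i = 0) ->
  \sum_(i < (2 * k).+1) F i = \sum_(i < k.+1) F (2 * i)%N.
Proof.
move=> F0; elim: k => [|k IHk]; first by rewrite !big_ord_recl !big_ord0.
rewrite mulnS !addSn big_ord_recr big_ord_recr /= IHk F0 ?addr0 //=; last by lia.
by rewrite [RHS]big_ord_recr /= mulnS !addSn.
Qed.

Lemma sum_even_termsS (V : nmodType) (F : nat -> V) k :
  (forall i, odd i -> F i = 0) ->
  \sum_(i < (2 * k).+2) F i = \sum_(i < k.+1) F (2 * i)%N.
Proof.
by move=> F0; rewrite big_ord_recr /= F0 ?addr0 ?sum_even_terms //=; lia.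
Qed.

Lemma sum_odd_termsS (V : nmodType) (F : nat -> V) k :
  (forall i, ~~ odd i -> F i = 0) ->
  \sum_(i < (2 * k).+2) F i = \sum_(i < k.+1) F (2 * i).+1.
Proof.
move=> F0; rewrite big_ord_recl F0 // add0r.
by rewrite -(sum_even_terms (F := fun i => F i.+1)) // => i oi; rewrite F0 //= oi.
Qed.

(** With [u = t^2], these four series in [u] are [cos t], [sin t / t], [sec t] and [tan t / t]. *)
Definition cos2 : series rat := fun k => (-1) ^+ k / (2 * k)`!%:R.
Definition sin2 : series rat := fun k => (-1) ^+ k / (2 * k).+1`!%:R.
Definition sec2 : series rat := fun k => fps_sec (2 * k)%N.
Definition tan2 : series rat := fun k => fps_tan (2 * k).+1.

Lemma cos_even k : fps_cos (2 * k)%N = cos2 k.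
Proof. by rewrite /fps_cos mul2n odd_double doubleK /cos2 mul2n. Qed.
Lemma sin_odd k : fps_sin (2 * k).+1 = sin2 k.
Proof. by rewrite /fps_sin mul2n /= odd_double /= uphalf_double /sin2 mul2n. Qed.

Lemma cos_mul_sec m : \sum_(i < m.+1) fps_cos i * fps_sec (m - i)%N = (m == 0%N)%:R.
Proof. exact: fps_mulV. Qed.

Lemma cos_oddE i : odd i -> fps_cos i = 0.
Proof. by rewrite /fps_cos => ->. Qed.

Lemma cos2_sec2 : cos2 * sec2 = 1.
Proof.
apply: seriesP => k; rewrite serME ser1E.
transitivity (\sum_(i < (2 * k).+1) fps_cos i * fps_sec (2 * k - i)%N).
  rewrite (sum_even_terms (F := fun i => fps_cos i * fps_sec (2 * k - i)%N)).
    by apply: eq_bigr => i _; rewrite cos_even -mulnBr.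
  by move=> i /cos_oddE ->; rewrite mul0r.
by rewrite cos_mul_sec muln_eq0.
Qed.

(** The odd coefficients of the secant form a series killed by the invertible series [cos2]. *)
Lemma sec_odd k : fps_sec (2 * k).+1 = 0.
Proof.
pose f : series rat := fun k => fps_sec (2 * k).+1.
suff f0 : cos2 * f = 0.
  by rewrite -[LHS]/(f k) -[f]mul1r -cos2_sec2 mulrAC f0 mul0r.
apply: seriesP => {}k; rewrite serME ser0E.
transitivity (\sum_(i < (2 * k).+2) fps_cos i * fps_sec ((2 * k).+1 - i)%N).
  rewrite (sum_even_termsS (F := fun i => fps_cos i * fps_sec ((2 * k).+1 - i)%N)).
    apply: eq_bigr => i _; rewrite cos_even /f; congr (_ * fps_sec _).
    by have := ltn_ord i; lia.
  by move=> i /cos_oddE ->; rewrite mul0r.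
by rewrite cos_mul_sec.
Qed.

Lemma sin2_sec2 : sin2 * sec2 = tan2.
Proof.
apply: seriesP => k; rewrite /tan2 /fps_tan /fps_mul serME.
rewrite (sum_odd_termsS (F := fun i => fps_sin i * fps_sec ((2 * k).+1 - i)%N)).
  by apply: eq_bigr => i _; rewrite sin_odd subSS -mulnBr.
by move=> i /negbTE oi; rewrite /fps_sin oi mul0r.
Qed.

Lemma tan_even k : fps_tan (2 * k)%N = 0.
Proof.
rewrite /fps_tan /fps_mul big1 // => i _; rewrite /fps_sin.
case: ifP => oi; last by rewrite mul0r.
have -> : (2 * k - i = (2 * (k - i./2.+1)).+1)%N by have := ltn_ord i; lia.
by rewrite sec_odd mulr0.
Qed.

Lemma euler_even k : euler (2 * k)%N = (2 * k)`!%:R * sec2 k.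
Proof. by rewrite /euler tan_even addr0. Qed.
Lemma euler_odd k : euler (2 * k).+1 = (2 * k).+1`!%:R * tan2 k.
Proof. by rewrite /euler sec_odd add0r. Qed.

(** The series of [t tan t / 2] in [u = t^2]. It is minus the logarithmic derivative of [cos2],
    hence the generating function of the power sums of the inverse roots. *)
Definition half_tan : series rat := fun k => if k is k'.+1 then tan2 k' / 2 else 0.

Lemma tan2_cos2 : tan2 * cos2 = sin2.
Proof. by rewrite -sin2_sec2 -mulrA [sec2 * _]mulrC cos2_sec2 mulr1. Qed.

Lemma half_tan_cos2 k : (half_tan * cos2) k.+1 = sin2 k / 2.
Proof.
rewrite serME big_ord_recl mul0r add0r -tan2_cos2 serME mulr_suml.
by apply: eq_bigr => i _; rewrite /= subSS mulrAC.
Qed.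

Lemma sD_cos2 : sD cos2 = - half_tan * cos2.
Proof.
apply: seriesP => -[|k]; first by rewrite /sD mul0r serM0E serNE oppr0 mul0r.
have e : (2 * k.+1 = (2 * k).+2)%N by lia.
rewrite mulNr serNE half_tan_cos2 /sD /cos2 /sin2 exprS e factS natrM -e natrM.
have := fact_neq0 (2 * k).+1; move: (_`!%:R) => f f0.
have : k.+1%:R != 0 :> rat by rewrite pnatr_eq0.
by move: (k.+1%:R) => x x0; field; rewrite f0.
Qed.

(** * Exponential series and Bernoulli numbers *)

Definition expser (c : rat) : series rat := fun n => c ^+ n / n`!%:R.

Lemma expserD a b : expser a * expser b = expser (a + b).
Proof.
apply: seriesP => n; rewrite serME /expser addrC exprDn mulr_suml.
apply: eq_bigr => i _.
have le_in : (i <= n)%N by rewrite -ltnS.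
have := bin_fact le_in => /(congr1 (fun m => m%:R : rat)); rewrite !natrM => <-.
rewrite -mulr_natr.
have f0 := fact_neq0 i; have g0 := fact_neq0 (n - i).
have b0 : 'C(n, i)%:R != 0 :> rat by rewrite pnatr_eq0 -lt0n bin_gt0.
by field; rewrite f0 g0 b0.
Qed.

Definition serX : series rat := fun n => (n == 1%N)%:R.

Lemma serX_mulS f n : (serX * f) n.+1 = f n.
Proof.
rewrite serME big_ord_recl big_ord_recl /= big1 => [|i _]; last by rewrite mul0r.
by rewrite mul0r add0r mul1r addr0 subSS subn0.
Qed.
Lemma serX_mul0 f : (serX * f) 0%N = 0.
Proof. by rewrite serM0E mul0r. Qed.

Definition dilate (c : rat) (f : series rat) : series rat := fun n => c ^+ n * f n.

Lemma dilateM c f g : dilate c (f * g) = dilate c f * dilate c g.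
Proof.
apply: seriesP => n; rewrite /dilate !serME mulr_sumr; apply: eq_bigr => i _.
have -> : c ^+ n = c ^+ i * c ^+ (n - i) by rewrite -exprD subnKC // -ltnS.
by ring.
Qed.

Definition bernser : series rat := fun n => bernoulli n / n`!%:R.

Lemma bernser_exp : bernser * (expser 1 - 1) = serX.
Proof.
pose e : series rat := fun j => j.+1`!%:R^-1.
have -> : expser 1 - 1 = serX * e.
  apply: seriesP => -[|n]; rewrite serBE ser1E ?serX_mul0 ?serX_mulS /expser.
    by rewrite divr1 subrr.
  by rewrite expr1n div1r subr0.
rewrite mulrCA [bernser * e](_ : _ = 1) ?mulr1 //; apply: seriesP => n.
rewrite mulrC ser1E -(@fps_mulV e) ?invr_eq0 ?fact_neq0 // serME.
apply: eq_bigr => i _; congr (_ * _); rewrite /bernser /bernoulli.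
by rewrite mulrC mulKf ?fact_neq0.
Qed.

(** Substitute [c t] for [t] in the defining identity of the Bernoulli series. *)
Lemma dilate_bernser_exp c :
  dilate c bernser * (expser c - 1) = fun n => if n == 1%N then c else 0.
Proof.
have -> : expser c - 1 = dilate c (expser 1 - 1).
  apply: seriesP => n; rewrite /dilate !serBE !ser1E /expser expr1n mulrBr.
  by rewrite mulrA mulr1; case: n => [|n] //=; rewrite ?mulr0 ?mulr1.
rewrite -dilateM bernser_exp; apply: seriesP => n; rewrite /dilate /serX.
by case: eqP => [->|_]; rewrite ?expr1 ?mulr1 ?mulr0.
Qed.

(* The series of [t tanh t]. *)
Definition ttanh : series rat := dilate 4 bernser - dilate 2 bernser + serX.

(** With [e = exp (2 t)], the definition of [ttanh] reads [4 t / (e^2 - 1) - 2 t / (e - 1) + t],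
    which is [t (e - 1) / (e + 1)]. Multiplying by [exp (- t)] turns [e + 1] and [e - 1] into the
    two sums of exponentials. *)
Lemma ttanh_cosh :
  (expser 1 + expser (-1)) * ttanh = serX * (expser 1 - expser (-1)).
Proof.
set e := expser 2.
have e4 : expser 4 = e * e by rewrite expserD.
have b2 : dilate 2 bernser * (e - 1) = serX + serX.
  rewrite dilate_bernser_exp; apply: seriesP => n.
  by rewrite serDE /serX; case: eqP.
have b4 : dilate 4 bernser * (e * e - 1) = serX + serX + serX + serX.
  rewrite -e4 dilate_bernser_exp; apply: seriesP => n.
  by rewrite !serDE /serX; case: eqP.
pose z := (e + 1) * ttanh - serX * (e - 1).
(* The factor [2 t] equals [dilate 2 bernser * (e - 1)], which clears the denominators, and
   multiplication by it is injective. *)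
have z0 : (serX + serX) * z = 0.
  rewrite -b2; transitivity (dilate 2 bernser * (dilate 4 bernser * (e * e - 1) -
    (e + 1) * (dilate 2 bernser * (e - 1)) + serX * (e * e - 1)
     - serX * (e - 1) * (e - 1))); first by rewrite /z /ttanh; ring.
  by rewrite b4 b2; ring.
have {}z0 : z = 0.
  apply: seriesP => n; rewrite ser0E.
  have := congr1 (fun f : series rat => f n.+1) z0.
  by rewrite mulrDl serDE serX_mulS ser0E => h; lra.
have em : expser (-1) * e = expser 1 by rewrite expserD.
have -> : expser 1 + expser (-1) = expser (-1) * (e + 1) by rewrite -em; ring.
have -> : expser 1 - expser (-1) = expser (-1) * (e - 1) by rewrite -em; ring.
apply/eqP; rewrite -subr_eq0; apply/eqP.
by transitivity (expser (-1) * z); [rewrite /z; ring | rewrite z0 mulr0].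
Qed.

Lemma expser_add_odd i : odd i -> (expser 1 + expser (-1)) i = 0.
Proof.
move=> oi; rewrite serDE /expser expr1n -signr_odd oi expr1.
by rewrite mul1r mulN1r subrr.
Qed.

(** This is [(i t) tanh (i t) = - t tan t] read on coefficients, the signs [(-1) ^+ k] standing for
    the powers of the imaginary unit. *)
Lemma ttanh_even k : (-1) ^+ k * ttanh (2 * k)%N = - (2 * half_tan k).
Proof.
pose f : series rat := fun k => (-1) ^+ k * ttanh (2 * k)%N.
suff fE : cos2 * f = - (half_tan + half_tan) * cos2.
  rewrite -[LHS]/(f k) -[f]mul1r -cos2_sec2 mulrAC fE -mulrA cos2_sec2 mulr1.
  by rewrite serNE serDE; lra.
apply: seriesP => {}k; have := congr1 (fun f : series rat => f (2 * k)%N) ttanh_cosh.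
rewrite serME (sum_even_terms
  (F := fun i => (expser 1 + expser (-1)) i * ttanh (2 * k - i)%N)); last first.
  by move=> i /expser_add_odd ->; rewrite mul0r.
(* The coefficient of index [2 i] in [exp t + exp (- t)] is [2 * (-1) ^+ i * cos2 i]. *)
rewrite (_ : \sum_(i < k.+1) _ = 2 * ((-1) ^+ k * (cos2 * f) k)); last first.
  rewrite serME !mulr_sumr; apply: eq_bigr => i _.
  rewrite serDE /expser expr1n exprM sqrrN !expr1n /cos2 /f -mulnBr.
  have -> : (-1) ^+ k = (-1) ^+ i * (-1) ^+ (k - i) :> rat.
    by rewrite -exprD subnKC // -ltnS.
  set a := (-1) ^+ i; set b := (-1) ^+ (k - i); set t := ttanh _; set g := _^-1.
  have a2 : a * a = 1 by rewrite -expr2 sqrr_sign.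
  have b2 : b * b = 1 by rewrite -expr2 sqrr_sign.
  by transitivity (2 * ((a * a) * g * ((b * b) * t))); [rewrite a2 b2|]; ring.
case: k => [|k] h.
  move: h; rewrite serX_mul0 expr0 mul1r => h.
  rewrite [RHS]serM0E serNE serDE addr0 oppr0 mul0r; lra.
rewrite mulNr serNE mulrDl serDE !half_tan_cos2.
move: h; rewrite mulnS serX_mulS serBE /expser expr1n.
rewrite !exprS exprM sqrrN !expr1n /sin2.
set s := (-1) ^+ k; have s2 : s * s = 1 by rewrite -expr2 sqrr_sign.
have := fact_neq0 (2 * k).+1; set g := _`!%:R => g0 h.
transitivity (- s * (2 * (-1 * s * (cos2 * f) k.+1)) / 2).
  by transitivity ((s * s) * (cos2 * f) k.+1); [rewrite s2 mul1r|field].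
by rewrite h; field.
Qed.

(** The left side is the coefficient of index [2 k + 2] in [ttanh], to which [serX] contributes
    nothing; [ttanh_even] evaluates it. *)
Lemma bernoulli_tan2 k :
  4 ^+ k.+1 * (4 ^+ k.+1 - 1) * bernoulli (2 * k.+1) / (2 * k.+1)`!%:R =
  (-1) ^+ k * tan2 k.
Proof.
have := ttanh_even k.+1; rewrite /half_tan /= mulrCA divff // mulr1.
rewrite /ttanh serDE serBE /serX /dilate /bernser.
rewrite (_ : 2 * k.+1 == 1 = false)%N ?addr0; last by lia.
have -> : 2 ^+ (2 * k.+1) = 4 ^+ k.+1 :> rat by rewrite exprM.
have -> : 4 ^+ (2 * k.+1) = 4 ^+ k.+1 * 4 ^+ k.+1 :> rat by rewrite -exprD mul2n addnn.
rewrite exprS; set s := (-1) ^+ k => h.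
have s2 : s * s = 1 by rewrite -expr2 sqrr_sign.
have -> : tan2 k = - - tan2 k by rewrite opprK.
rewrite -h; set x := 4 ^+ k.+1; set b := bernoulli _; set g := _^-1.
by transitivity ((s * s) * (x * (x - 1) * b * g)); [rewrite s2 mul1r|]; ring.
Qed.

(** * Alternating permutations *)

Section Alternating.
Local Open Scope nat_scope.

(** Counted from position 0 the pattern is [s 0 < s 1 > s 2 < ...], which is what a cyclically
    alternating permutation leaves once a maximum in position 0 is deleted. *)
Definition alternating m (s : 'S_m) : bool :=
  [forall i : 'I_m, forall j : 'I_m,
    (j == i.+1 :> nat) ==> if odd i then s j < s i else s i < s j].

Lemma alternatingP m (s : 'S_m) :
  reflect (forall i j : 'I_m, j = i.+1 :> nat ->
             if odd i then s j < s i else s i < s j)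
          (alternating s).
Proof.
apply: (iffP forallP) => [H i j /eqP ji|H i]; last first.
  by apply/forallP => j; apply/implyP => /eqP; apply: H.
by have /forallP/(_ j)/implyP/(_ ji) := H i.
Qed.

Lemma lift_perm_bij n (i : 'I_n.+1) :
  bijective (fun p : 'I_n.+1 * 'S_n => lift_perm i p.1 p.2).
Proof.
apply: inj_card_bij; last by rewrite card_prod card_ord !card_Sn factS.
move=> [k s] [k' s'] /= E.
have kk' : k = k' by have := congr1 (fun w : 'S__ => w i) E; rewrite !lift_perm_id.
rewrite -{}kk' in E *; congr (_, _); apply/permP => j.
have := congr1 (fun w : 'S__ => w (lift i j)) E.
by rewrite !lift_perm_lift => /lift_inj.
Qed.

Lemma card_lift_perm n (i k : 'I_n.+1) (P : pred 'S_n.+1) :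
  #|[set w | P w & w i == k]| = #|[set s | P (lift_perm i k s)]|.
Proof.
have inj : injective (@lift_perm n i k).
  move=> s s' E; have [g gK _] := lift_perm_bij i.
  by have := congr1 g E; rewrite (gK (k, s)) (gK (k, s')) => -[].
rewrite -(card_imset _ inj); apply: eq_card => w; rewrite !inE.
apply/andP/imsetP => [[Pw /eqP wi]|[s]]; last first.
  by rewrite inE => Ps ->; rewrite lift_perm_id.
have [g _ gK] := lift_perm_bij i; have := gK w; case: (g w) => k' s /= E.
have kk' : k' = k by rewrite -wi -E lift_perm_id.
by exists s; rewrite ?inE -kk' E.
Qed.

Lemma ltn_bump h i j : (bump h i < bump h j) = (i < j).
Proof. by rewrite !ltnNge leq_bump2. Qed.

(** [lift k] raises by one the values that are at least [k], so that [k < lift k x] becomes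
    [k <= x]. *)
Lemma alternating_lift_max m (k : 'I_m.+2) (s : 'S_m.+1) :
  alternating (lift_perm ord_max k s) =
  alternating s && (if odd m then k <= s ord_max else s ord_max < k).
Proof.
have val_lift (i : 'I_m.+1) : lift ord_max i = i :> nat.
  by rewrite /= /bump leqNgt ltn_ord.
have cmp_last : (if odd m then k < lift k (s ord_max) else lift k (s ord_max) < k)
    = (if odd m then k <= s ord_max else s ord_max < k).
  by rewrite /= /bump; case: leqP => h; case: ifP => _; lia.
apply/alternatingP/andP => [H|[/alternatingP H1 H2] i j].
  split; last first.
    rewrite -cmp_last; have := H (lift ord_max ord_max) ord_max.
    by rewrite lift_perm_id lift_perm_lift !val_lift; apply.
  apply/alternatingP => i j ji; have := H (lift ord_max i) (lift ord_max j).
  by rewrite !lift_perm_lift !val_lift /= !ltn_bump; apply.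
case: (unliftP ord_max j) => [j' ->|-> /=].
  case: (unliftP ord_max i) => [i' ->|->]; rewrite ?val_lift => ji.
    by rewrite !lift_perm_lift /= !ltn_bump; apply: H1.
  by have := ltn_ord j'; rewrite ji /=; lia.
move=> [mi]; have -> : i = lift ord_max ord_max by apply: ord_inj; rewrite val_lift.
by rewrite lift_perm_id lift_perm_lift val_lift cmp_last.
Qed.

Definition altn m : nat := #|[set s : 'S_m | alternating s]|.

(** The Entringer numbers: once the last value is recorded, deleting it gives a recursion on [m]. *)
Definition entringer m k : nat :=
  #|[set s : 'S_m.+1 | alternating s & s ord_max == k :> nat]|.

Lemma card_alternating_last m (P : pred nat) :
  #|[set s : 'S_m.+1 | alternating s & P (s ord_max)]| =
  \sum_(l < m.+1 | P l) entringer m l.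
Proof.
rewrite -sum1_card (partition_big (fun s : 'S__ => s ord_max) P) => [|s]; last first.
  by rewrite inE => /andP[].
apply: eq_bigr => l Pl; rewrite /entringer -sum1_card; apply: eq_bigl => s.
by rewrite !inE -andbA val_eqE; case: eqP => [->|_]; rewrite ?Pl ?andbF ?andbT.
Qed.

Lemma altnS m : altn m.+1 = \sum_(l < m.+1) entringer m l.
Proof.
rewrite -(card_alternating_last m predT).
by apply: eq_card => s; rewrite !inE andbT.
Qed.

Lemma entringerS m k : k <= m.+1 ->
  entringer m.+1 k =
  \sum_(l < m.+1 | if odd m then k <= l else l < k) entringer m l.
Proof.
move=> le_k; rewrite /entringer; have lt_k : k < m.+2 by [].
rewrite (card_lift_perm ord_max (Ordinal lt_k)).
rewrite -(card_alternating_last m (fun l => if odd m then k <= l else l < k)).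
by apply: eq_card => s; rewrite !inE alternating_lift_max.
Qed.

Lemma altn0 : altn 0 = 1.
Proof.
rewrite /altn -[RHS](card_Sn 0) -cardsT; apply: eq_card => s; rewrite !inE.
by apply/alternatingP => -[].
Qed.

Lemma entringer00 : entringer 0 0 = 1.
Proof.
rewrite /entringer -[RHS](card_Sn 1) -cardsT; apply: eq_card => s; rewrite !inE.
rewrite [s _]ord1 eqxx andbT.
by apply/alternatingP => i j; rewrite [i]ord1 [j]ord1.
Qed.

Lemma sum_bin_ltn n c : \sum_(l < n) 'C(l, c) = 'C(n, c.+1).
Proof.
by elim: n => [|n IHn]; rewrite ?big_ord0 // big_ord_recr /= IHn binS addnC.
Qed.

End Alternating.

(** For [c = 0] this is a closed form of the Entringer numbers [entringer (2 * r) k]. By the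
    hockey-stick identity, summing over [l < k] increases [c] by one. *)
Definition entsum (c r k : nat) : rat :=
  \sum_(j < r.+1) (-1) ^+ (r - j) * (altn (2 * j))%:R * 'C(k, 2 * (r - j) + c)%:R.

Lemma sum_entsum c r n : \sum_(l < n) entsum c r l = entsum c.+1 r n.
Proof.
rewrite exchange_big; apply: eq_bigr => j _.
by rewrite -mulr_sumr -natr_sum sum_bin_ltn addnS.
Qed.

(** The term [j = r + 1] has binomial coefficient 1 and splits off; in the others, passing from [r]
    to [r + 1] changes the sign and adds 2 to the lower index. *)
Lemma entsumS r k : entsum 0 r.+1 k = (altn (2 * r.+1))%:R - entsum 2 r k.
Proof.
rewrite /entsum big_ord_recr /= subnn muln0 bin0 mulr1 expr0 mul1r addrC.
congr (_ + _); rewrite -sumrN; apply: eq_bigr => j _.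
have lt_j : (j <= r)%N by rewrite -ltnS.
by rewrite subSn // exprS !mulNr mul1r mulnS addn0 addnC.
Qed.

Lemma entringer_step r :
  (forall k, (k <= 2 * r)%N -> (entringer (2 * r) k)%:R = entsum 0 r k) ->
  forall k, (k <= (2 * r).+1)%N -> (entringer (2 * r).+1 k)%:R = entsum 1 r k.
Proof.
move=> IH k le_k; rewrite entringerS // oddM /= -sum_entsum natr_sum.
rewrite (big_ord_widen_cond _ (fun=> true) (fun l => entsum 0 r l) le_k).
by apply: eq_big => // l _; rewrite IH // -ltnS.
Qed.

Lemma altn_odd_entsum r :
  (forall k, (k <= 2 * r)%N -> (entringer (2 * r) k)%:R = entsum 0 r k) ->
  (altn (2 * r).+1)%:R = entsum 1 r (2 * r).+1.
Proof.
move=> IH; rewrite altnS natr_sum -sum_entsum; apply: eq_bigr => l _.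
by rewrite IH // -ltnS.
Qed.

Lemma altn_even_entsum r :
  (forall k, (k <= 2 * r)%N -> (entringer (2 * r) k)%:R = entsum 0 r k) ->
  (altn (2 * r.+1))%:R = entsum 2 r (2 * r.+1).
Proof.
move=> IH; rewrite mulnS altnS natr_sum -sum_entsum; apply: eq_bigr => l _.
by rewrite entringer_step // -ltnS.
Qed.

(** Each induction step applies the recursion twice. From an even index it sums over [l < k]; from
    an odd one over [l >= k], which is the total [altn] minus the sum over [l < k]. *)
Lemma entringerE r k : (k <= 2 * r)%N -> (entringer (2 * r) k)%:R = entsum 0 r k.
Proof.
elim: r k => [|r IHr] k le_k.
  have -> : k = 0%N by lia.
  by rewrite entringer00 /entsum big_ord_recl big_ord0 altn0 !mul1r addr0.
rewrite entsumS -sum_entsum mulnS entringerS; last by lia.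
rewrite /= oddM /= natr_sum altnS natr_sum.
have le_k2 : (k <= (2 * r).+2)%N by lia.
rewrite (big_ord_widen_cond _ (fun=> true) (fun l => entsum 1 r l) le_k2).
apply/eqP; rewrite -subr_eq opprK; apply/eqP.
rewrite [RHS](bigID (fun l : 'I__ => k <= l)%N) /=; congr (_ + _).
apply: eq_big => [l|l _]; first by rewrite -ltnNge.
by rewrite entringer_step // -ltnS.
Qed.

Definition altser : series rat := fun j => (altn (2 * j))%:R / (2 * j)`!%:R.

Lemma bin_divf m k : (k <= m)%N ->
  'C(m, k)%:R / m`!%:R = (k`!%:R * (m - k)`!%:R)^-1 :> rat.
Proof.
move=> le_km; rewrite -(bin_fact le_km) !natrM.
have := fact_neq0 k; have := fact_neq0 (m - k).
have b0 : 'C(m, k)%:R != 0 :> rat by rewrite pnatr_eq0 -lt0n bin_gt0.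
by move=> f0 g0; field; rewrite f0 g0 b0.
Qed.

(** At [k = 2 r + c] the binomial coefficient divided by the factorial is a product of two inverse
    factorials, and [entsum] becomes a convolution with [altser]. *)
Lemma entsum_divf c r : 
  entsum c r (2 * r + c) / (2 * r + c)`!%:R =
  \sum_(j < r.+1) (-1) ^+ (r - j) / (2 * (r - j) + c)`!%:R * altser j.
Proof.
rewrite mulr_suml; apply: eq_bigr => j _; rewrite -!mulrA; congr (_ * _).
have lt_j : (j <= r)%N by rewrite -ltnS.
rewrite bin_divf; last by lia.
have -> : (2 * r + c - (2 * (r - j) + c) = 2 * j)%N by lia.
by rewrite /altser invfM; ring.
Qed.

(** In positive degree, the recursion for [altn] in even length makes the last term of the
    convolution [altser * cos2] cancel all the others. *)
Lemma altser_sec2 : altser = sec2.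
Proof.
suff E : cos2 * altser = 1.
  by rewrite -[altser]mul1r -cos2_sec2 mulrAC E mul1r.
apply: seriesP => -[|r].
  by rewrite serM0E /altser /cos2 muln0 altn0 fact0 expr0 divr1 mulr1.
rewrite mulrC serME ser1E big_ord_recr /= subnn.
have -> : cos2 0%N = 1 by rewrite /cos2 muln0 fact0 expr0 divr1.
rewrite mulr1 [altser r.+1]/altser.
rewrite (altn_even_entsum (@entringerE r)) mulnS addnC entsum_divf -big_split.
apply: big1 => j _; have lt_j : (j <= r)%N by rewrite -ltnS.
by rewrite /= /cos2 subSn // exprS mulnS [(2 + _)%N]addnC; ring.
Qed.

Lemma altn_tan2 r : (altn (2 * r).+1)%:R = (2 * r).+1`!%:R * tan2 r.
Proof.
rewrite (altn_odd_entsum (@entringerE r)).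
apply: (mulIf (invr_neq0 (fact_neq0 (2 * r).+1))).
rewrite [RHS]mulrAC divff ?fact_neq0 // mul1r.
have := entsum_divf 1 r; rewrite addn1 => ->.
rewrite -sin2_sec2 -altser_sec2 mulrC serME.
by apply: eq_bigr => j _; rewrite mulrC /sin2 addn1.
Qed.

(** The tangent numbers count permutations. This sign is what evaluates the absolute values of
    [phi]. *)
Lemma tan2_ge0 r : 0 <= tan2 r.
Proof.
rewrite -(@pmulr_rge0 _ (2 * r).+1`!%:R) ?ltr0n ?fact_gt0 //.
by rewrite -altn_tan2 ler0n.
Qed.

Lemma altn_euler r : (altn (2 * r).+1)%:R = euler (2 * r).+1.
Proof. by rewrite altn_tan2 euler_odd. Qed.

(** * Cyclically alternating permutations *)

Section CyclicallyAlternating.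
Local Open Scope nat_scope.
Variable n : nat.
Let m := (2 * n).+1.

Definition cyca (w : 'S_m.+1) : bool :=
  [forall i : 'I_m.+1, if odd i then w i < w (ordS i) else w (ordS i) < w i].

(** Rotation by two positions keeps parities, hence acts on the cyclically alternating
    permutations. *)
Let rot2_inj : injective (fun i : 'I_m.+1 => ordS (ordS i)).
Proof. by move=> i j /ordS_inj/ordS_inj. Qed.
Let rot2 : 'S_m.+1 := perm rot2_inj.

Let odd_rot2 (i : 'I_m.+1) : odd (rot2 i) = odd i.
Proof.
have odd_ordS (j : 'I_m.+1) : odd (ordS j) = ~~ odd j.
  rewrite /=; have [lt|] := ltnP j m; first by rewrite modn_small.
  move=> le; have -> : j = m :> nat by have := ltn_ord j; lia.
  by rewrite modnn /= oddM.
by rewrite permE !odd_ordS negbK.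
Qed.

Let cyca_rot2 w : cyca (rot2 * w) = cyca w.
Proof.
apply/forallP/forallP => H i; last first.
  by have := H (rot2 i); rewrite odd_rot2 !permM !permE.
have := H (rot2^-1 i)%g; rewrite -odd_rot2 permKV !permM permKV.
suff -> : rot2 (ordS (rot2^-1 i)%g) = ordS i by [].
by rewrite -[in RHS](permKV rot2 i) !permE.
Qed.

Let top_at (i : 'I_m.+1) := #|[set w | cyca w & w i == ord_max]|.

Let top_at_rot2 i : top_at (rot2 i) = top_at i.
Proof.
rewrite /top_at -[RHS](card_preimset _ (mulgI rot2)); apply: eq_card => w.
by rewrite !inE cyca_rot2 permM.
Qed.

Let top_at_even k : 2 * k < m.+1 -> top_at (inord (2 * k)) = top_at ord0.
Proof.
elim: k => [|k IHk] lt_k; first by congr top_at; apply: ord_inj; rewrite inordK.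
rewrite -IHk; last by lia.
rewrite -[RHS]top_at_rot2.
congr top_at; apply: ord_inj; rewrite permE /= !inordK; try by lia.
by rewrite !modn_small; lia.
Qed.

(** Counted from 0, an odd position holds a smaller value than its successor. *)
Let top_at_odd (i : 'I_m.+1) : odd i -> top_at i = 0.
Proof.
move=> oi; apply/eqP; rewrite cards_eq0; apply/eqP/setP => w; rewrite !inE.
apply/negP => /andP[/forallP/(_ i)]; rewrite oi => lt /eqP wi.
by move: lt; rewrite wi ltnNge -ltnS ltn_ord.
Qed.

Let cyca_lift (s : 'S_m) : cyca (lift_perm ord0 ord_max s) = alternating s.
Proof.
have val_lift (i : 'I_m) : lift ord_max i = i :> nat.
  by rewrite /= /bump leqNgt ltn_ord.
have ordSE (i : 'I_m.+1) : ordS i = i.+1 %% m.+1 :> nat by [].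
apply/forallP/alternatingP => [H i j ji|H i].
  have := H (lift ord0 i).
  have -> : ordS (lift ord0 i) = lift ord0 j.
    apply: ord_inj; rewrite ordSE !lift0 ji modn_small //.
    by rewrite ltnS -ji ltn_ord.
  rewrite !lift_perm_lift !val_lift lift0 /=.
  by case: (odd i).
case: (unliftP ord0 i) => [i' ->|->].
  rewrite !lift_perm_lift !val_lift.
  have [lt|le] := ltnP i'.+1 m.
    have -> : ordS (lift ord0 i') = lift ord0 (Ordinal lt).
      by apply: ord_inj; rewrite ordSE !lift0 modn_small.
    rewrite lift_perm_lift val_lift lift0 /=.
    by have := H i' (Ordinal lt) erefl; case: (odd i').
  have E : i'.+1 = m by have := ltn_ord i'; lia.
  have -> : ordS (lift ord0 i') = ord0.
    by apply: ord_inj; rewrite ordSE lift0 E modnn.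
  rewrite lift_perm_id lift0 E.
  have -> : odd m by rewrite /= oddM.
  exact: ltn_ord.
have -> : ordS (ord0 : 'I_m.+1) = lift ord0 (ord0 : 'I_m) by exact: ord_inj.
rewrite lift_perm_id lift_perm_lift val_lift.
exact: ltn_ord.
Qed.

(** Sort by the position of the maximum: odd positions are impossible, the [n + 1] even ones are
    exchanged by rotations, and deleting a maximum in position 0 leaves an alternating permutation
    of length [m]. *)
Lemma card_cyca : #|[set w | cyca w]| = n.+1 * altn m.
Proof.
have -> : #|[set w | cyca w]| = \sum_i top_at i.
  rewrite -sum1_card (partition_big (fun w : 'S_m.+1 => (w^-1)%g ord_max) predT) //.
  apply: eq_bigr => i _; rewrite /top_at -sum1_card; apply: eq_bigl => w.
  by rewrite !inE -(inj_eq (@perm_inj _ w)) permKV eq_sym.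
pose F i := if i < m.+1 then top_at (inord i) else 0.
transitivity (\sum_(i < m.+1) F i).
  by apply: eq_bigr => i _; rewrite /F inord_val ltn_ord.
rewrite (@sum_even_termsS nat F) => [|i oi]; last first.
  by rewrite /F; case: ifP => // lt; rewrite top_at_odd // inordK.
rewrite -[n.+1 in RHS]card_ord -sum_nat_const; apply: eq_bigr => k _.
have lt_k : 2 * k < m.+1 by have := ltn_ord k; rewrite /m; lia.
rewrite /F lt_k top_at_even // /top_at card_lift_perm.
by apply: eq_card => s; rewrite !inE cyca_lift.
Qed.
End CyclicallyAlternating.

Lemma card_cyc_alternating n : (1 <= n)%N ->
  n%:R * euler (2 * n - 1) = #|[set w : 'S_(2 * n) | cyc_alternating w]|%:R.
Proof.
case: n => // n _; have e : (2 * n.+1 = (2 * n).+2)%N by lia.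
have -> : #|[set w : 'S_(2 * n.+1) | cyc_alternating w]| =
          #|[set w : 'S_(2 * n).+2 | cyca w]|.
  (* The two sizes are equal but not convertible, so the size is generalised before rewriting. *)
  by rewrite /cyc_alternating; move: (2 * n.+1)%N e => _ ->.
by rewrite card_cyca natrM altn_euler e subn1.
Qed.

(** * Partitions and the exponential formula *)

Lemma mkpart_parts (l : intpart) : mkpart l = l.
Proof. by rewrite -{2}(mkpartK l 0) cats0. Qed.

Lemma geq_total : total geq.
Proof. by move=> i j; apply: leq_total. Qed.
Lemma geq_trans : transitive geq.
Proof. by move=> j i k ji kj; apply: leq_trans kj ji. Qed.
Lemma geq_anti : antisymmetric geq.
Proof. by move=> i j ij; apply: anti_leq; rewrite andbC. Qed.

Lemma mkpart_perm s t : perm_eq s t -> mkpart s = mkpart t.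
Proof.
move=> st; apply: val_inj => /=.
by apply/(perm_sortP geq_total geq_trans geq_anti); apply: perm_filter.
Qed.

Lemma perm_mkpart s : perm_eq (mkpart s) (filter (leq 1) s).
Proof. by rewrite perm_sort. Qed.

Lemma count_mkpart k s : (0 < k)%N -> count_mem k (mkpart s) = count_mem k s.
Proof.
move=> k0; rewrite (seq.permP (perm_mkpart s)) count_filter.
by apply: eq_count => x /=; case: eqP => // ->.
Qed.

(** The partition gives the nonzero entries up to order, and the common length then fixes the number
    of zeros. *)
Lemma mkpart_perm_eq s t : size s = size t -> mkpart s = mkpart t -> perm_eq s t.
Proof.
move=> szE E; have pf : perm_eq (filter (leq 1) s) (filter (leq 1) t).
  by rewrite -(permPl (perm_mkpart s)) E perm_mkpart.
have count0 u : count_mem 0%N u = (size u - size (filter (leq 1) u))%N.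
  rewrite size_filter -(count_predC (leq 1) u) addKn; apply: eq_count => x /=.
  by case: x.
apply/allP => k _ /=; case: k => [|k]; first by rewrite !count0 szE (perm_size pf).
by rewrite -(@count_mkpart _ s) // -(@count_mkpart _ t) // E.
Qed.

Lemma intpart_gt0 (l : intpart) k : k \in parts l -> (0 < k)%N.
Proof.
by case: l => s /= /andP[_ s0] ks; rewrite lt0n; apply: contraNneq s0 => <-.
Qed.

Lemma uniq_partitions n : uniq (partitions n).
Proof. exact: undup_uniq. Qed.

Definition addpart k (l : intpart) : intpart := mkpart (k :: l).

Lemma perm_addpart k l : (0 < k)%N -> perm_eq (addpart k l) (k :: l).
Proof.
move=> k0; rewrite (permPl (perm_mkpart _)) /= k0 perm_cons.
by rewrite perm_sym -(permPr (perm_mkpart l)) mkpart_parts.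
Qed.

Lemma addpart_inj k : (0 < k)%N -> injective (addpart k).
Proof.
move=> k0 l l' E; rewrite -[l]mkpart_parts -[l']mkpart_parts; apply: mkpart_perm.
rewrite -(perm_cons k) -(permPl (perm_addpart l k0)) E.
exact: perm_addpart.
Qed.

(** Deleting one part [k] inverts [addpart k]. *)
Lemma perm_partitions_mem n k : (0 < k <= n)%N ->
  perm_eq [seq l <- partitions n | k \in parts l]
          [seq addpart k l | l <- partitions (n - k)].
Proof.
move=> /andP[k0 le_kn]; apply: uniq_perm.
- by rewrite filter_uniq ?uniq_partitions.
- by rewrite (map_inj_uniq (addpart_inj k0)) uniq_partitions.
move=> l; rewrite mem_filter mem_partitions; apply/andP/mapP => [[kl /eqP sl]|].
  have pl : perm_eq l (k :: mkpart (rem k l)).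
    rewrite (permPl (perm_to_rem kl)) perm_cons perm_sym (permPl (perm_mkpart _)).
    have /all_filterP -> : all (leq 1) (rem k l); last exact: perm_refl.
    by apply/allP => x /mem_rem /intpart_gt0.
  exists (mkpart (rem k l)); last by rewrite -[LHS]mkpart_parts; apply: mkpart_perm.
  rewrite mem_partitions -(addKn k (sumn _)) -[(k + _)%N]/(sumn (k :: _)).
  by rewrite -(perm_sumn pl) sl.
case=> l'; rewrite mem_partitions => /eqP sl' ->.
have pl := perm_addpart l' k0.
by rewrite (perm_mem pl) mem_head (perm_sumn pl) /= sl' subnKC.
Qed.

Definition multfact n (l : intpart) : nat := \prod_(1 <= k < n.+1) (count_mem k l)`!.

Lemma multfact_gt0 n l : (0 < multfact n l)%N.
Proof. by rewrite prodn_gt0 // => k; rewrite fact_gt0. Qed.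

Lemma multfact_addpart n k l : (0 < k <= n)%N ->
  multfact n (addpart k l) = (count_mem k (addpart k l) * multfact n l)%N.
Proof.
move=> /andP[k0 le_kn]; have pl := perm_addpart l k0.
have kin : k \in index_iota 1 n.+1 by rewrite mem_index_iota k0.
rewrite /multfact (bigD1_seq k) ?iota_uniq //= [in RHS](bigD1_seq k) ?iota_uniq //=.
rewrite (seq.permP pl) /= eqxx add1n factS -mulnA; congr (_ * (_ * _))%N.
by apply: eq_bigr => j jk; rewrite (seq.permP pl) /= eq_sym (negbTE jk).
Qed.

Lemma multfact_widen n m (l : intpart) : (sumn l <= n)%N -> (n <= m)%N ->
  multfact m l = multfact n l.
Proof.
move=> ln nm; rewrite /multfact (@big_cat_nat _ _ _ n.+1) //=.
rewrite [X in (_ * X)%N]big1_seq ?muln1 //.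
move=> k; rewrite mem_index_iota => /andP[_ /andP[lt_nk _]].
rewrite (count_memPn _) //; apply/negP => /leq_mem_sumn; lia.
Qed.

Lemma sumn_count n (s : seq nat) : all (fun k => 0 < k <= n)%N s ->
  (\sum_(1 <= k < n.+1) k * count_mem k s)%N = sumn s.
Proof.
elim: s => [_|x s IHs /= /andP[xn /IHs <-]].
  by rewrite big1 // => k; rewrite muln0.
under eq_bigr do rewrite mulnDr; rewrite big_split /=; congr (_ + _)%N.
rewrite (bigD1_seq x) ?iota_uniq ?mem_index_iota //= eqxx muln1 big1 ?addn0 //.
by move=> k /negbTE kx; rewrite eq_sym kx muln0.
Qed.

Section Recursion.
Variable (R : comAlgType rat) (b : nat -> R).

(* The coefficients of [exp (\sum_(k >= 1) b k t^k)]. *)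
Definition expcoef : series R := fun n =>
  \sum_(l <- partitions n) (multfact n l)%:R^-1 *: \prod_(k <- parts l) b k.

Definition logder : series R := fun k => k%:R * b k.

(* Removing one part [k] from a partition in which [k] has multiplicity [m_k]
   divides [\prod_k m_k!] by [m_k]; summing [k m_k] over [k] gives the size. *)
Lemma sD_expcoef : sD expcoef = logder * expcoef.
Proof.
apply: seriesP => n; rewrite serME /sD big_ord_recl /= {1}/logder !mul0r add0r.
pose T k (l : intpart) : R := (k * count_mem k l)%:R *:
   ((multfact n l)%:R^-1 *: \prod_(k <- parts l) b k).
transitivity (\sum_(l <- partitions n) \sum_(1 <= k < n.+1) T k l).
  rewrite mulr_sumr !big_seq; apply: eq_bigr => l; rewrite mem_partitions => /eqP ln.
  rewrite -scaler_suml -natr_sum sumn_count ?ln ?scaler_nat ?mulr_natl //.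
  by apply/allP => k kl; rewrite (intpart_gt0 kl) -ln leq_mem_sumn.
rewrite exchange_big big_add1 big_mkord /=; apply: eq_bigr => k _.
have kn : (0 < k.+1 <= n)%N := ltn_ord k.
transitivity (\sum_(l <- [seq l <- partitions n | k.+1 \in parts l]) T k.+1 l).
  rewrite big_filter [RHS]big_mkcond /=; apply: eq_bigr => l _.
  by case: ifP => // /negbT /count_memPn kl; rewrite /T kl muln0 scale0r.
rewrite (perm_big _ (perm_partitions_mem kn)) big_map /expcoef mulr_sumr /=.
rewrite !big_seq; apply: eq_bigr => l; rewrite mem_partitions => /eqP ln.
rewrite /T multfact_addpart //; set c := count_mem _ _.
have c0 : c%:R != 0 :> rat.
  by rewrite pnatr_eq0 /c (seq.permP (perm_addpart l _)) //= eqxx.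
have m0 : (multfact n l)%:R != 0 :> rat by rewrite pnatr_eq0 -lt0n multfact_gt0.
rewrite (perm_big _ (perm_addpart l _)) //= big_cons.
rewrite (multfact_widen (n := n - k.+1)) ?ln // ?leq_subr // in m0 *.
set g := \prod_(_ <- _) _; set m := (multfact _ _) in m0 *.
rewrite scalerA !natrM.
have -> : k.+1%:R * c%:R * (c%:R * m%:R)^-1 = k.+1%:R * m%:R^-1 :> rat.
  by field; rewrite c0 m0.
by rewrite -scalerA scaler_nat /logder mulr_natl mulrnAl -scalerAr.
Qed.

Lemma expcoef0 : expcoef 0%N = 1.
Proof.
rewrite /expcoef.
have -> : partitions 0 = [:: mkpart [::]].
  apply: perm_small_eq => //; apply: uniq_perm; rewrite ?uniq_partitions // => l.
  rewrite mem_partitions inE; apply/eqP/eqP => [l0|->]; last by rewrite sumn_mkpart.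
  have /nilP E : nilp l by rewrite /nilp -leqn0 -l0 size_intpart.
  by rewrite -[l]mkpart_parts E.
by rewrite big_seq1 /multfact big_geq // invr1 scale1r big_nil.
Qed.
End Recursion.

(** The equation is the recursion [m f_m = \sum_(0 < i <= m) a_i f_(m - i)]. It determines [f] from
    [f_0] because positive integers are regular, and up to degree [n] it involves only the terms of
    [a] up to [n]. *)
Lemma eqtrunc_sD (R : comNzRingType) n (a a' f g : series R) :
  (forall m, GRing.lreg (m.+1%:R : R)) ->
  sD f = a * f -> sD g = a' * g -> a 0%N = 0 -> f 0%N = g 0%N ->
  eqtrunc n a a' -> eqtrunc n f g.
Proof.
move=> reg sDf sDg a0 fg0 aa'; elim/ltn_ind => -[|m] IH le_mn //.
apply: (reg m); rewrite -[LHS]/(sD f m.+1) -[RHS]/(sD g m.+1) sDf sDg !serME.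
rewrite big_ord_recl [RHS]big_ord_recl -(aa' 0%N) // a0 !mul0r; congr (_ + _).
apply: eq_bigr => i _; rewrite /= /bump /= add1n aa'; last first.
  by apply: leq_trans le_mn; rewrite ltnS -ltnS.
by rewrite IH // ?subSS ?ltnS ?leq_subr // (leq_trans _ (ltnW le_mn)) // leq_subr.
Qed.

(** * Generating function of the complete symmetric functions *)

(** The product of the [1 - z t] is the reversal of the product of the [X - z]. *)
Lemma prod_linE (R : comNzRingType) (r : seq R) k :
  (\prod_(z <- r) lin z) k =
  if (k <= size r)%N then (\prod_(z <- r) ('X - z%:P))`_(size r - k) else 0.
Proof.
elim: r k => [|z r IHr] k.
  by rewrite !big_nil ser1E; case: k => [|k] /=; rewrite ?coef1.
have Q0 : (\prod_(z <- r) ('X - z%:P))`_(size r).+1 = 0.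
  by rewrite nth_default // size_prod_XsubC.
rewrite !big_cons mulrBl; case: k => [|k].
  by rewrite serM0E mul1r IHr /= !subn0 coefB coefXM coefCM Q0 mulr0 subr0.
rewrite serM_linE !IHr /= subSS ltnS coefB coefXM coefCM.
case: (ltngtP k (size r)) => [lt_k|lt_k|->]; last by rewrite subnn.
  by rewrite subnS; case: (size r - k)%N (subn_gt0 k (size r)) => [|m] //; rewrite lt_k.
by rewrite mulr0 subr0.
Qed.

(** The [y_i] are the roots of the reversed truncation of [a], which is monic because [a 0 = 1] and
    splits over [algC]. Vieta's formulas give the elementary symmetric values. *)
Lemma prod_lin_roots n (a : series algC) : a 0%N = 1 ->
  exists y : n.-tuple algC,
    eqtrunc n (\prod_(i < n) lin (tnth y i)) a /\
    forall k, (k <= n)%N -> (mesym n algC k).@[tnth y] = (-1) ^+ k * a k.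
Proof.
move=> a0; pose q : {poly algC} := \poly_(i < n.+1) a (n - i)%N.
have qn : q`_n = 1 by rewrite coef_poly ltnSn subnn.
have sz_q : size q = n.+1.
  by apply: size_poly_eq; rewrite subnn a0 oner_eq0.
have lq : lead_coef q = 1 by rewrite lead_coefE sz_q.
have [r] := closed_field_poly_normal q; rewrite lq scale1r => qE.
have sz_r : size r == n by rewrite -eqSS -(size_prod_XsubC r id) -qE sz_q.
exists (Tuple sz_r).
have coefq k : (k <= n)%N -> q`_(n - k) = a k.
  by move=> kn; rewrite coef_poly ltnS leq_subr subKn.
split=> k kn.
  rewrite -(big_tuple _ _ (Tuple sz_r) predT (@lin algC)) prod_linE /= -qE (eqP sz_r) kn.
  exact: coefq.
have := mroots_coeff (Tuple sz_r) (inord k); rewrite /= -qE inordK // coefq // => ->.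
by rewrite signrMK.
Qed.

Lemma prod_lin_geo (R : comNzRingType) I (r : seq I) (x : I -> R) :
  (\prod_(i <- r) lin (x i)) * (\prod_(i <- r) geo (x i)) = 1.
Proof. by rewrite -big_split big1 // => i _; rewrite /= lin_geo. Qed.

Lemma sum_powers0 (R : comNzRingType) I (r : seq I) (x : I -> R) :
  (\sum_(i <- r) powers (x i)) 0%N = 0.
Proof. by rewrite ser_sumE big1. Qed.

Lemma sum_powersE (R : comNzRingType) I (r : seq I) (x : I -> R) k :
  (0 < k)%N -> (\sum_(i <- r) powers (x i)) k = \sum_(i <- r) x i ^+ k.
Proof. by case: k => // k _; rewrite ser_sumE. Qed.

Lemma rmorph_prod_geo (R S : comNzRingType) (phi : {rmorphism R -> S}) r
    (x : 'I_r -> R) k :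
  phi ((\prod_i geo (x i)) k) = (\prod_i geo (phi (x i))) k.
Proof.
rewrite !ser_prodE rmorph_sum; apply: eq_bigr => f _.
by rewrite rmorph_prod; apply: eq_bigr => i _; rewrite rmorphXn.
Qed.

Lemma prod_geo_scale (R : comNzRingType) r (y : R) (x : 'I_r -> R) k :
  (\prod_i geo (y * x i)) k = y ^+ k * (\prod_i geo (x i)) k.
Proof.
rewrite !ser_prodE mulr_sumr; apply: eq_bigr => f /eqP fk.
rewrite /geo; under eq_bigr do rewrite exprMn.
by rewrite big_split prodrXr fk.
Qed.

Lemma sym_hE k N : sym_h k N = (\prod_(i < N) geo ('X_i : {mpoly rat[N]})) k.
Proof.
rewrite ser_prodE /sym_h.
have b0 : (mdeg (0%MM : 'X_{1..N}) < k.+1)%N by rewrite mdeg0.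
(* The default is taken only when the exponents sum to more than [k], and such [f] do not occur in
   the sum. *)
pose h (f : {ffun 'I_N -> 'I_k.+1}) : 'X_{1..N < k.+1} :=
  insubd (BMultinom b0) [multinom (f i : nat) | i < N].
pose h' (m : 'X_{1..N < k.+1}) : {ffun 'I_N -> 'I_k.+1} :=
  [ffun i => inord ((m : 'X_{1..N}) i)].
have le_deg (m : 'X_{1..N < k.+1}) i : ((m : 'X_{1..N}) i < k.+1)%N.
  apply: leq_ltn_trans (bmdeg m); rewrite mdegE (bigD1 i) //=; exact: leq_addr.
have hK (f : {ffun 'I_N -> 'I_k.+1}) :
    (\sum_i f i)%N = k -> h f = [multinom (f i : nat) | i < N] :> 'X_{1..N}.
  move=> fk; rewrite /h insubdK // unfold_in mdegE.
  by under eq_bigr do rewrite mnmE; rewrite fk.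
rewrite (reindex_onto h h') /=.
  apply: eq_big => [f|f /andP[fk /eqP ff]].
    apply/andP/eqP => [[/eqP mk /eqP ff]|fk]; last first.
      split; first by rewrite hK // mdegE; under eq_bigr do rewrite mnmE; rewrite fk.
      by apply/eqP/ffunP => i; rewrite ffunE hK // mnmE inord_val.
    rewrite -[RHS]mk mdegE; apply: eq_bigr => i _.
    by rewrite -{1}ff ffunE inordK.
  rewrite mpolyXE_id; apply: eq_bigr => i _.
  by rewrite /geo -{2}ff ffunE inordK.
move=> m _; apply: val_inj; apply/mnmP => i.
rewrite /h insubdK ?mnmE ?ffunE ?inordK //.
rewrite unfold_in mdegE; under eq_bigr do rewrite mnmE ffunE inordK //.
by rewrite -mdegE bmdeg.
Qed.

(** * Uniqueness of the expansion in the h basis *)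

Notation qalg := (ratr : rat -> algC).

(** An increasing sequence of primes, not necessarily consecutive ones. *)
Fixpoint nth_prime k : nat :=
  if k is k'.+1 then s2val (prime_above (nth_prime k')) else 2.

Lemma prime_nth_prime k : prime (nth_prime k).
Proof. by case: k => //= k; case: prime_above. Qed.

Lemma nth_prime_inj : injective nth_prime.
Proof.
have mono : {homo nth_prime : i j / (i < j)%N}.
  by apply: homo_ltn => [|i]; [exact: ltn_trans | rewrite /=; case: prime_above].
by move=> i j E; case: (ltngtP i j) => // /mono; rewrite E ltnn.
Qed.

(** A label multiplicative in the parts which, by unique factorisation, determines the partition. *)
Definition godel (l : intpart) : nat := \prod_(k <- parts l) nth_prime k.

Lemma logn_godel k l : logn (nth_prime k) (godel l) = count_mem k l.
Proof.
rewrite /godel; elim: (parts l) => [|x s IHs]; first by rewrite big_nil logn1.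
have p0 i : (0 < nth_prime i)%N by rewrite prime_gt0 ?prime_nth_prime.
rewrite big_cons lognM ?p0 ?prodn_gt0 //.
rewrite IHs /= logn_prime ?prime_nth_prime // (inj_eq nth_prime_inj).
by rewrite eq_sym.
Qed.

Lemma godel_inj : injective godel.
Proof.
move=> l l' E; rewrite -[l]mkpart_parts -[l']mkpart_parts; apply: mkpart_perm.
by apply/allP => k _; rewrite /= -!logn_godel E.
Qed.

(* The [x_i] are the inverse roots of the truncation of
   [1 / (1 + v_1 t + v_2 t^2 + ...)]. *)
Lemma sym_h_values n (v : series rat) : v 0%N = 1 ->
  exists x : 'I_n -> algC, forall k, (k <= n)%N ->
    mmap qalg x (sym_h k n) = qalg (v k).
Proof.
move=> v0; pose a : series algC := fun k => qalg (fps_inv v k).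
pose w : series algC := fun k => qalg (v k).
have wa : w * a = 1.
  apply: seriesP => m; rewrite serME ser1E.
  transitivity (qalg (fps_mul v (fps_inv v) m)).
    by rewrite rmorph_sum; apply: eq_bigr => i _; rewrite rmorphM.
  by rewrite fps_mulV ?v0 // rmorph_nat.
have a0 : a 0%N = 1.
  have := congr1 (fun f : series algC => f 0%N) wa.
  by rewrite serM0E {1}/w v0 rmorph1 mul1r.
have [y [ya _]] := prod_lin_roots n a0.
exists (tnth y) => k kn.
rewrite sym_hE (rmorph_prod_geo (mmap qalg (tnth y))).
under eq_bigr do rewrite /= mmapX mmap1U.
have aw : a * w = 1 by rewrite mulrC.
exact: (eqtrunc_inv (prod_lin_geo _ (tnth y)) aw ya).
Qed.

(** Giving each [h_k] with [k > 0] the value [nth_prime k ^ z], for every [z], shows that [d] is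
    orthogonal to all powers of [godel], hence to all polynomials in it. A polynomial vanishing at
    all the labels but one isolates [d l]. *)
Lemma sym_h_part_indep (r : seq intpart) (d : intpart -> rat) : uniq r ->
  (forall N, \sum_(l <- r) d l *: sym_h_part l N = 0) ->
  forall l, l \in r -> d l = 0.
Proof.
move=> r_uniq rd0.
(* All parts are at most [n], so [n] variables suffice to prescribe the values of the [h_k]
   involved. *)
pose n := (\sum_(l <- r) sumn l)%N.
have le_n l k : l \in r -> k \in parts l -> (k <= n)%N.
  move=> lr /leq_mem_sumn /leq_trans; apply.
  by rewrite /n (bigD1_seq l) //= leq_addr.
have val0 (v : series rat) : v 0%N = 1 ->
    \sum_(l <- r) d l * \prod_(k <- parts l) v k = 0.
  move=> v0; have [x hx] := sym_h_values n v0.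
  have := congr1 (mmap qalg x) (rd0 n); rewrite mmap0 rmorph_sum /= => E.
  apply/eqP; rewrite -(fmorph_eq0 qalg) rmorph_sum /= -[X in _ == X]E !big_seq.
  apply/eqP; apply: eq_bigr => l lr.
  rewrite mmapZ rmorphM /sym_h_part !rmorph_prod /=; congr (_ * _).
  by rewrite !big_seq; apply: eq_bigr => k kl; rewrite hx // (le_n _ _ lr kl).
have pow0 z : \sum_(l <- r) d l * (godel l)%:R ^+ z = 0.
  pose v : series rat := fun k => if k is 0%N then 1 else (nth_prime k)%:R ^+ z.
  rewrite -[RHS](val0 v) //; apply: eq_bigr => l _; congr (_ * _).
  rewrite /godel natr_prod -prodrXl !big_seq; apply: eq_bigr => k /intpart_gt0.
  by case: k.
have pol0 (p : {poly rat}) : \sum_(l <- r) d l * p.[(godel l)%:R] = 0.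
  under eq_bigr do rewrite horner_coef mulr_sumr.
  rewrite exchange_big big1 //= => i _.
  under eq_bigr do rewrite mulrCA.
  by rewrite -mulr_sumr pow0 mulr0.
move=> l lr; pose g (m : intpart) : rat := (godel m)%:R.
have g_inj : injective g by move=> m m' /eqP; rewrite eqr_nat => /eqP/godel_inj.
pose p : {poly rat} := \prod_(x <- [seq g m | m <- rem l r]) ('X - x%:P).
have rootp m : root p (g m) = (m \in rem l r).
  by rewrite root_prod_XsubC mem_map.
have := pol0 p; rewrite (bigD1_seq l) //= big_seq_cond big1 ?addr0 => [|m].
  move/eqP; rewrite mulf_eq0 => /orP[/eqP //|].
  by rewrite -[_ == 0]/(root p (g l)) rootp mem_rem_uniq // inE eqxx.
move=> /andP[mr ml]; suff /rootP -> : root p (g m) by rewrite mulr0.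
by rewrite rootp mem_rem_uniq // inE ml.
Qed.

Lemma big_finsupp (V : lmodType rat) (c : {fsfun intpart -> rat with 0})
    (r : seq intpart) (F : intpart -> V) :
  uniq r -> {subset finsupp c <= r} ->
  \sum_(l <- finsupp c) c l *: F l = \sum_(l <- r) c l *: F l.
Proof.
move=> r_uniq sub; rewrite [RHS](bigID (fun l => l \in finsupp c)) /=.
rewrite [X in _ + X]big1 => [|l]; last first.
  by rewrite mem_finsupp negbK => /eqP ->; rewrite scale0r.
rewrite addr0 -[RHS]big_filter; apply: perm_big; apply: uniq_perm.
- exact: fset_uniq.
- exact: filter_uniq.
by move=> l; rewrite mem_filter; apply/idP/andP => [lc|[]//]; rewrite lc sub.
Qed.

Lemma h_expansion_inj f c c' : h_expansion f c -> h_expansion f c' -> c = c'.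
Proof.
move=> fc fc'; pose r := undup (finsupp c ++ finsupp c').
have r_uniq : uniq r by apply: undup_uniq.
have subc : {subset finsupp c <= r} by move=> l lc; rewrite mem_undup mem_cat lc.
have subc' : {subset finsupp c' <= r}.
  by move=> l lc; rewrite mem_undup mem_cat lc orbT.
have d0 := @sym_h_part_indep r (fun l => c l - c' l) r_uniq.
apply/fsfunP => l; case: (boolP (l \in r)) => [lr|]; last first.
  rewrite mem_undup mem_cat negb_or !mem_finsupp !negbK => /andP[/eqP -> /eqP ->].
  by [].
apply/eqP; rewrite -subr_eq0; apply/eqP; apply: d0 lr => N.
under eq_bigr do rewrite scalerBl.
rewrite sumrB -(big_finsupp _ r_uniq subc) -(big_finsupp _ r_uniq subc').
by rewrite -fc -fc' subrr.
Qed.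

(** * Monomial symmetric functions *)

Section Monomials.
Variable n : nat.
Implicit Types f g : {ffun 'I_n -> 'I_n.+1}.

Definition exponents f : seq nat := [seq (f j : nat) | j <- enum 'I_n].
Definition fpart f : intpart := mkpart (exponents f).

Lemma sumn_fpart f : sumn (fpart f) = (\sum_j f j)%N.
Proof. by rewrite sumn_mkpart sumnE big_map big_enum. Qed.

Lemma fpart_eq f g : fpart f = fpart g -> exists s : 'S_n, forall j, f j = g (s j).
Proof.
move=> /mkpart_perm_eq; rewrite !size_map => /(_ erefl) fg.
pose t (h : {ffun 'I_n -> 'I_n.+1}) := [tuple (h j : nat) | j < n].
have tE h : t h = exponents h :> seq nat by [].
have /tuple_permP[s sE] : perm_eq (t f) (t g) by rewrite !tE.
exists s => j; apply: ord_inj.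
have := congr1 (fun u => nth 0%N u j) sE.
by rewrite -!tnth_nth !tnth_mktuple.
Qed.

Lemma fpart_perm f g (s : 'S_n) : (forall j, f j = g (s j)) -> fpart f = fpart g.
Proof.
move=> fg; apply: mkpart_perm; rewrite /exponents.
have -> : [seq (f j : nat) | j <- enum 'I_n] =
          [seq (g j : nat) | j <- [seq s j | j <- enum 'I_n]].
  by rewrite -[RHS]map_comp; apply: eq_map => j /=; rewrite fg.
apply: (perm_map (fun j => g j : nat)); apply: uniq_perm; rewrite ?enum_uniq //.
  by rewrite map_inj_uniq ?enum_uniq //; apply: perm_inj.
move=> j; rewrite mem_enum; apply/mapP; exists ((s^-1)%g j); rewrite ?mem_enum //.
by rewrite permKV.
Qed.

Lemma fpart_support f (r : seq 'I_n) : uniq r ->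
  (forall j, (0 < f j)%N = (j \in r)) -> fpart f = mkpart [seq (f j : nat) | j <- r].
Proof.
move=> r_uniq rE; rewrite /fpart.
have -> : mkpart (exponents f) = mkpart (filter (leq 1) (exponents f)).
  by apply: val_inj; rewrite /= filter_id.
apply: mkpart_perm; rewrite /exponents filter_map; apply: perm_map.
apply: uniq_perm => // [|j]; first exact/filter_uniq/enum_uniq.
by rewrite mem_filter mem_enum andbT /= rE.
Qed.

Section Values.
Variables (R : comNzRingType) (y : 'I_n -> R).

(** The monomial symmetric function [m_l(y)], for partitions [l] whose parts are at most [n]. *)
Definition mono (l : intpart) : R := \sum_(f | fpart f == l) \prod_j y j ^+ f j.

(** Monomials are grouped by the partition that their exponents form; [h 0 = 1] lets the zero
    exponents be dropped. *)
Lemma sum_mono_mul (h : nat -> R) : h 0%N = 1 ->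
  \sum_(f : {ffun 'I_n -> 'I_n.+1} | (\sum_j f j)%N == n)
    \prod_j (y j ^+ f j * h (f j)) =
  \sum_(l <- partitions n) mono l * \prod_(k <- parts l) h k.
Proof.
move=> h0; have hpart s : \prod_(k <- parts (mkpart s)) h k = \prod_(k <- s) h k.
  rewrite (perm_big _ (perm_mkpart s)) big_filter [LHS]big_mkcond.
  by apply: eq_bigr => -[|k] _ /=.
under [RHS]eq_bigr do rewrite mulr_suml.
rewrite (exchange_big_dep predT) //= [LHS]big_mkcond /=; apply: eq_bigr => f _.
case: ifP => fn; last first.
  rewrite big1_seq // => l /andP[/eqP <-]; rewrite mem_partitions sumn_fpart.
  by rewrite fn.
rewrite -[RHS]big_filter (_ : filter _ _ = [:: fpart f]) ?big_seq1; last first.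
  apply: perm_small_eq => //; apply: uniq_perm => [||l] //.
    exact/filter_uniq/uniq_partitions.
  rewrite mem_filter inE eq_sym; case: eqP => // ->.
  by rewrite mem_partitions sumn_fpart.
by rewrite hpart big_map big_enum /= big_split.
Qed.

Lemma sum_mono :
  \sum_(l <- partitions n) mono l = (\prod_j geo (y j)) n.
Proof.
rewrite ser_prodE; have := @sum_mono_mul (fun=> 1) erefl.
under eq_bigr do under eq_bigr do rewrite mulr1.
by move=> ->; apply: eq_bigr => l _; rewrite big1 ?mulr1.
Qed.

Lemma mono_nseq1 : (0 < n)%N -> mono (mkpart (nseq n 1%N)) = \prod_j y j.
Proof.
move=> n0; pose f1 : {ffun 'I_n -> 'I_n.+1} := [ffun=> inord 1].
have f1E j : f1 j = 1%N :> nat by rewrite ffunE inordK.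
have E1 : exponents f1 = nseq n 1%N.
  have sz : size (exponents f1) = n by rewrite size_map size_enum_ord.
  apply: (@eq_from_nth _ 0%N) => [|i]; rewrite sz ?size_nseq // => lt_i.
  by rewrite (nth_map (Ordinal lt_i)) ?size_enum_ord // f1E nth_nseq lt_i.
rewrite /mono (big_pred1 f1) => [|f].
  by apply: eq_bigr => j _; rewrite f1E expr1.
rewrite -E1 -/(fpart f1) /=; apply/eqP/eqP => [|-> //] /fpart_eq[s sE].
by apply/ffunP => j; rewrite sE !ffunE.
Qed.

(** The exponent functions of type [(n)] are those concentrated at a single index. *)
Lemma mono1 : (0 < n)%N -> mono (mkpart [:: n]) = \sum_j y j ^+ n.
Proof.
move=> n0; pose d (i : 'I_n) : {ffun 'I_n -> 'I_n.+1} :=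
  [ffun j => if j == i then ord_max else ord0].
have dE i j : d i j = (if j == i then n else 0)%N :> nat by rewrite ffunE; case: eqP.
have d_inj : injective d.
  move=> i i' E; apply/eqP; apply: contraTT n0 => ii'.
  by have := dE i' i; rewrite -E dE eqxx (negbTE ii') => ->.
have fpart_d i : fpart (d i) = mkpart [:: n].
  rewrite (@fpart_support _ [:: i]) //= ?dE ?eqxx // => j.
  by rewrite dE inE; case: eqP.
rewrite /mono (eq_bigl (fun f => f \in [set d i | i : 'I_n])) => [|f].
  rewrite big_imset /=; last by move=> i j _ _; apply: d_inj.
  apply: eq_bigr => i _; rewrite (bigD1 i) //= dE eqxx big1 ?mulr1 // => j ji.
  by rewrite dE (negbTE ji) expr0.
apply/eqP/imsetP => [|[i _ ->]]; last exact: fpart_d.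
rewrite -(fpart_d (Ordinal n0)) => /fpart_eq[s sE]; exists ((s^-1)%g (Ordinal n0)) => //.
apply/ffunP => j; rewrite sE !ffunE; congr (if _ then _ else _).
by rewrite -(inj_eq (@perm_inj _ s) j) permKV.
Qed.

(** Expand the product of power sums over pairs of indices: the diagonal gives [p_n], and every
    other pair a monomial of type [(a, b)]. Such a monomial comes from one ordered pair, or from two
    opposite ones when [a = b]. *)
Lemma mono2 a b : (0 < a)%N -> (0 < b)%N -> (a + b)%N = n ->
  (if a == b then 2 else 1)%:R * mono (mkpart [:: a; b]) =
  (\sum_j y j ^+ a) * (\sum_j y j ^+ b) - \sum_j y j ^+ n.
Proof.
move=> a0 b0 abn; pose d (p : 'I_n * 'I_n) : {ffun 'I_n -> 'I_n.+1} :=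
  [ffun j => if j == p.1 then inord a else if j == p.2 then inord b else ord0].
have dE p j : d p j =
    (if j == p.1 then a else if j == p.2 then b else 0)%N :> nat.
  by rewrite ffunE; case: eqP => _; [|case: eqP => _ //]; rewrite inordK //; lia.
have fpart_d p : p.1 != p.2 -> fpart (d p) = mkpart [:: a; b].
  move=> p12; rewrite (@fpart_support _ [:: p.1; p.2]) /= ?inE ?p12 //.
    by rewrite !dE eqxx [p.2 == p.1]eq_sym (negbTE p12) eqxx.
  by move=> j; rewrite dE !inE; case: eqP => _; [rewrite a0|case: eqP; rewrite ?b0].
have split2 : (\sum_j y j ^+ a) * (\sum_j y j ^+ b) - \sum_j y j ^+ n =
    \sum_(p : 'I_n * 'I_n | p.1 != p.2) y p.1 ^+ a * y p.2 ^+ b.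
  rewrite mulr_suml; under eq_bigr do rewrite mulr_sumr.
  rewrite pair_big /= (bigID (fun p : 'I_n * 'I_n => p.1 == p.2)) /= addrAC.
  rewrite [X in X - _](_ : _ = \sum_j y j ^+ n) ?subrr ?add0r //.
  rewrite -(pair_big_dep xpredT (fun i j => i == j) (fun i j => y i ^+ a * y j ^+ b)) /=.
  apply: eq_bigr => i _; rewrite (big_pred1 i) => [|j]; last by rewrite /= eq_sym.
  by rewrite -exprD abn.
rewrite split2.
have prod_d (p : 'I_n * 'I_n) : p.1 != p.2 ->
    \prod_j y j ^+ d p j = y p.1 ^+ a * y p.2 ^+ b.
  move=> p12; rewrite (bigD1 p.1) //= dE eqxx; congr (_ * _).
  rewrite (bigD1 p.2) 1?eq_sym //= dE [p.2 == p.1]eq_sym (negbTE p12) eqxx.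
  rewrite big1 ?mulr1 // => j /andP[/negbTE j1 /negbTE j2].
  by rewrite dE j1 j2 expr0.
rewrite -(eq_bigr _ prod_d).
rewrite (partition_big d (fun f => fpart f == mkpart [:: a; b])) /=; last first.
  by move=> p p12; rewrite fpart_d.
rewrite mulr_sumr; apply: eq_bigr => f /eqP fE.
rewrite [RHS](eq_bigr (fun=> \prod_j y j ^+ f j)); last by move=> p /andP[_ /eqP ->].
rewrite sumr_const -[RHS]mulr_natl; congr (_%:R * _).
have lt1n : (1 < n)%N by lia.
have [p0 p012 ->] : exists2 p0 : 'I_n * 'I_n, p0.1 != p0.2 & f = d p0.
  (* Every exponent function of type [(a, b)] is a rearrangement of the one given by the reference
     pair [(0, 1)]. *)
  pose q : 'I_n * 'I_n := (Ordinal (ltnW lt1n), Ordinal lt1n).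
  have /fpart_eq[s sE] : fpart f = fpart (d q) by rewrite fE fpart_d.
  exists ((s^-1)%g q.1, (s^-1)%g q.2); first by rewrite (inj_eq perm_inj).
  by apply/ffunP => j; rewrite sE !ffunE -!(inj_eq (@perm_inj _ s) j) !permKV.
have key p : p.1 != p.2 -> d p = d p0 ->
    (if a == b then (p == p0) || (p == (p0.2, p0.1)) else p == p0).
  move=> p12 E; have := dE p0 p.1; have := dE p0 p.2; rewrite -E !dE !eqxx.
  move: p p0 p12 p012 {E} => [i j] [k l] /=; rewrite !xpair_eqE [j == i]eq_sym.
  move=> /negbTE ij /negbTE kl; rewrite ij => hj hi.
  have [ab|ab] := eqVneq a b.
    have {}hi : (i == k) || (i == l).
      by move: hi; case: (i == k); case: (i == l) => //=; lia.
    have {}hj : (j == k) || (j == l).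
      by move: hj; case: (j == k); case: (j == l) => //=; lia.
    by case/orP: hi ij => /eqP ->; case/orP: hj => /eqP ->; rewrite ?eqxx ?orbT.
  have -> : i == k by move: hi; case: (i == k); case: (i == l) => //=; lia.
  by move: hj; case: (j == k); case: (j == l) => //=; lia.
have swapE : a = b -> d (p0.2, p0.1) = d p0.
  move=> ab; apply/ffunP => j; apply: ord_inj; rewrite !dE /= ab.
  by case: eqP => // _; case: eqP.
have [ab|ab] := eqVneq a b.
  transitivity #|[set p0; (p0.2, p0.1)]|.
    rewrite cards2; suff -> : p0 != (p0.2, p0.1) by [].
    by rewrite -pair_eqE /= negb_and p012.
  apply: eq_card => p; rewrite !inE; apply/idP/andP => [|[p12 /eqP E]]; last first.
    by have := key p p12 E; rewrite ab eqxx.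
  by case/orP => /eqP ->; rewrite ?p012 ?eqxx //= eq_sym p012 swapE.
transitivity #|pred1 p0|; first by rewrite card1.
apply: eq_card => p; rewrite !inE.
apply/eqP/andP => [->|[p12 /eqP E]]; first by rewrite p012.
by have := key p p12 E; rewrite (negbTE ab) => /eqP.
Qed.

End Values.
End Monomials.

(** * The expansion of A_n *)

Lemma rmorph_mono n (R S : comNzRingType) (phi : {rmorphism R -> S})
    (y : 'I_n -> R) l :
  phi (mono y l) = mono (fun j => phi (y j)) l.
Proof.
rewrite rmorph_sum; apply: eq_bigr => f _; rewrite rmorph_prod.
by apply: eq_bigr => j _; rewrite rmorphXn.
Qed.

Lemma eq_mono n (R : comNzRingType) (y z : 'I_n -> R) l :
  y =1 z -> mono y l = mono z l.
Proof.
by move=> yz; apply: eq_bigr => f _; apply: eq_bigr => j _; rewrite yz.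
Qed.

Lemma mono_perm n (R : comNzRingType) (y : 'I_n -> R) (s : 'S_n) l :
  mono (fun j => y (s j)) l = mono y l.
Proof.
pose h (f : {ffun 'I_n -> 'I_n.+1}) : {ffun 'I_n -> 'I_n.+1} := [ffun j => f (s j)].
pose h' (f : {ffun 'I_n -> 'I_n.+1}) : {ffun 'I_n -> 'I_n.+1} :=
  [ffun j => f ((s^-1)%g j)].
have hK : cancel h h' by move=> f; apply/ffunP => j; rewrite !ffunE permKV.
have h'K : cancel h' h by move=> f; apply/ffunP => j; rewrite !ffunE permK.
rewrite /mono (reindex h) /=; last by exists h' => f _; [apply: hK | apply: h'K].
apply: eq_big => [f|f _].
  by rewrite (@fpart_perm _ (h f) f s) // => j; rewrite ffunE.
rewrite [RHS](reindex_inj (@perm_inj _ s)) /=.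
by apply: eq_bigr => j _; rewrite ffunE.
Qed.

(** By the fundamental theorem on symmetric polynomials, [m_l] in generic variables is a rational
    polynomial in the elementary ones, whose values at [y] are rational by hypothesis. *)
Lemma mono_rat n (y : 'I_n -> algC) (e : nat -> rat) :
  (forall k, (k <= n)%N -> (mesym n algC k).@[y] = qalg (e k)) ->
  forall l, exists q, mono y l = qalg q.
Proof.
move=> ye l; pose x (j : 'I_n) : {mpoly rat[n]} := 'X_j.
have symM : mono x l \is symmetric.
  apply/issymP => s; rewrite rmorph_mono -[RHS](mono_perm _ s).
  apply: eq_mono => j; rewrite /= /x msymX; congr 'X_[_]; apply/mnmP => i.
  by rewrite !mnmE -(inj_eq (@perm_inj _ s)) permKV.
have [t [tE _]] := sym_fundamental symM.
have xE : (fun j => mmap qalg y (x j)) =1 y by move=> j; rewrite mmapX mmap1U.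
have eE k : (k <= n)%N -> mmap qalg y (mesym n rat k) = qalg (e k).
  move=> kn; rewrite -ye // /mesym !rmorph_sum; apply: eq_bigr => h _.
  by rewrite !rmorph_prod; apply: eq_bigr => i _; rewrite /= mevalXU mmapX mmap1U.
exists (\sum_(m <- msupp t) t@_m * \prod_(i < n) e i.+1 ^+ m i).
rewrite -(eq_mono l xE) -(rmorph_mono (mmap qalg y)) -tE comp_mpolyE !rmorph_sum.
apply: eq_bigr => m _; rewrite /= mmapZ rmorphM !rmorph_prod; congr (_ * _).
by apply: eq_bigr => i _; rewrite tnth_mktuple !rmorphXn /= eE.
Qed.

Definition qser (f : series rat) : series algC := fun k => qalg (f k).

Lemma qserM f g : qser (f * g) = qser f * qser g.
Proof.
apply: seriesP => n; rewrite serME /qser serME rmorph_sum.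
by apply: eq_bigr => i _; rewrite rmorphM.
Qed.

(** * Inverse roots of the truncated cosine *)

Section Roots.
Variables (n : nat) (y : 'I_n -> algC).
Hypothesis y_cos : eqtrunc n (\prod_i lin (y i)) (qser cos2).

Lemma prod_geo_roots : eqtrunc n (\prod_i geo (y i)) (qser sec2).
Proof.
apply: (eqtrunc_inv (prod_lin_geo _ y)) y_cos; rewrite -qserM cos2_sec2.
by apply: seriesP => k; rewrite /qser !ser1E rmorph_nat.
Qed.

(** Both sides are minus a logarithmic derivative, one of the product of the [lin (y i)] and the
    other of [cos2], and these two series agree up to degree [n]. *)
Lemma sum_powers_roots : eqtrunc n (\sum_i powers (y i)) (qser half_tan).
Proof.
have -> : \sum_i powers (y i) = - sD (\prod_i lin (y i)) * \prod_i geo (y i).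
  rewrite (@sD_prod _ _ _ _ _ (fun i => - powers (y i))) => [|i]; last exact: sD_lin.
  by rewrite sumrN !mulNr opprK -mulrA prod_lin_geo mulr1.
have -> : qser half_tan = (- sD (qser cos2)) * qser sec2.
  have -> : half_tan = (- sD cos2) * sec2.
    by rewrite sD_cos2 !mulNr opprK -mulrA cos2_sec2 mulr1.
  rewrite qserM; congr (_ * _); apply: seriesP => k.
  by rewrite /qser !serNE /sD rmorphN rmorphM rmorph_nat.
by apply: eqtruncM prod_geo_roots => k kn; rewrite !serNE /sD y_cos.
Qed.

Lemma power_sum_roots k : (0 < k <= n)%N -> \sum_i y i ^+ k = qalg (half_tan k).
Proof. by case/andP=> k0 kn; rewrite -sum_powersE // sum_powers_roots. Qed.

End Roots.

Definition phi_coef (k : nat) : rat :=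
  (4 ^+ k * (4 ^+ k - 1) * bernoulli (2 * k)) / ((2 * k)%:R * (2 * k)`!%:R).

(** By [bernoulli_tan2], the absolute value removes exactly the sign [(-1) ^+ (k - 1)], the tangent
    coefficients being nonnegative. *)
Lemma phi_coef_half_tan k : (0 < k)%N -> k%:R * `|phi_coef k| = half_tan k.
Proof.
case: k => // k _; have -> : phi_coef k.+1 = (-1) ^+ k * tan2 k / (2 * k.+1)%:R.
  rewrite -bernoulli_tan2 /phi_coef.
  by rewrite invfM mulrA mulrAC.
rewrite !normrM normr_sign mul1r ger0_norm ?tan2_ge0 // normfV normr_nat natrM.
rewrite /half_tan; have : k.+1%:R != 0 :> rat by rewrite pnatr_eq0.
by move: (k.+1%:R) => x x0; field.
Qed.

Lemma prod_count (R : comNzRingType) n (F : nat -> R) (s : seq nat) :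
  all (fun k => 0 < k <= n)%N s ->
  \prod_(1 <= k < n.+1) F k ^+ count_mem k s = \prod_(k <- s) F k.
Proof.
elim: s => [_|x s IHs /= /andP[xn /IHs sE]]; first by rewrite big1 ?big_nil.
rewrite big_cons -sE; under eq_bigr do rewrite exprD; rewrite big_split /=.
congr (_ * _); rewrite (bigD1_seq x) ?iota_uniq ?mem_index_iota //= eqxx expr1.
by rewrite big1 ?mulr1 // => k /negbTE kx; rewrite eq_sym kx expr0.
Qed.

Lemma norm_phi n (l : intpart) : sumn l = n ->
  `|phi l| = (2 * n)`!%:R *
    ((multfact n l)%:R^-1 * \prod_(k <- parts l) `|phi_coef k|).
Proof.
move=> ln; have ln_all : all (fun k => 0 < k <= n)%N l.
  by apply/allP => k kl; rewrite (intpart_gt0 kl) -ln leq_mem_sumn.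
rewrite /phi ln normrM normr_nat big_split /= normrM !normr_prod.
congr (_ * (_ * _)).
  rewrite /multfact natr_prod -prodfV; apply: eq_bigr => k _.
  by rewrite normfV normr_nat.
rewrite -(prod_count _ ln_all); apply: eq_bigr => k _.
by rewrite normrX.
Qed.

Definition p_weight N k : {mpoly rat[N]} := `|phi_coef k| *: sym_p k N.

Lemma scaled_symA n N :
  scale_symfun (2 * n)`!%:R (symA n) N = (2 * n)`!%:R *: expcoef (p_weight N) n.
Proof.
rewrite /scale_symfun /symA scalerA divff ?fact_neq0 // scale1r scaler_sumr.
rewrite !big_seq; apply: eq_bigr => l; rewrite mem_partitions => /eqP ln.
rewrite (norm_phi ln) -!scalerA; congr (_ *: (_ *: _)).
rewrite /sym_p_part; elim: (parts l) => [|k s IHs]; first by rewrite !big_nil scale1r.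
by rewrite !big_cons -IHs /p_weight -scalerAl -scalerAr scalerA.
Qed.

(** The series [F] and [G] have logarithmic derivatives with coefficients [k |c_k| p_k(x)] and
    [p_k(y) p_k(x)], where [c_k] is [phi_coef k]. These agree up to degree [n], hence so do [F] and
    [G]. *)
Lemma expcoef_mono n (y : 'I_n -> algC) N :
  eqtrunc n (\prod_i lin (y i)) (qser cos2) ->
  map_mpoly qalg (expcoef (p_weight N) n) =
  \sum_(l <- partitions n) mono y l *: map_mpoly qalg (sym_h_part l N).
Proof.
move=> y_cos; pose x (i : 'I_N) : {mpoly algC[N]} := 'X_i.
pose z (j : 'I_n) : {mpoly algC[N]} := (y j)%:MP.
pose G : series {mpoly algC[N]} := \prod_j \prod_i geo (z j * x i).
pose F : series {mpoly algC[N]} := fun k => map_mpoly qalg (expcoef (p_weight N) k).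
pose A : series {mpoly algC[N]} := fun k => map_mpoly qalg (logder (p_weight N) k).
have map_X i : map_mpoly qalg 'X_i = x i by rewrite map_mpolyX.
have sDF : sD F = A * F.
  apply: seriesP => k; rewrite serME.
  have := congr1 (fun f : series _ => map_mpoly qalg (f k)) (sD_expcoef (p_weight N)).
  rewrite serME rmorph_sum /= /sD rmorphM rmorph_nat => ->.
  by apply: eq_bigr => i _; rewrite rmorphM.
pose B := \sum_j \sum_i powers (z j * x i).
have sDG : sD G = B * G.
  apply: sD_prod => j; apply: sD_prod => i; exact: sD_geo.
have A0 : A 0%N = 0 by rewrite /A /logder mul0r rmorph0.
have B0 : B 0%N = 0.
  by rewrite /B ser_sumE big1 // => j _; rewrite sum_powers0.
have AB : eqtrunc n A B.
  move=> k kn; case: (posnP k) => [->|k0]; first by rewrite A0 B0.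
  rewrite /B ser_sumE; under eq_bigr do rewrite sum_powersE //.
  under eq_bigr do under eq_bigr do rewrite exprMn.
  under eq_bigr do rewrite -mulr_sumr.
  rewrite -mulr_suml /A /logder /p_weight mulr_natl -scaler_nat scalerA.
  rewrite phi_coef_half_tan // map_mpolyZ -mul_mpolyC; congr (_ * _).
    rewrite /= -(power_sum_roots y_cos) ?k0 // rmorph_sum.
    by apply: eq_bigr => j _; rewrite rmorphXn.
  rewrite rmorph_sum; apply: eq_bigr => i _.
  by rewrite rmorphXn /= map_X.
have F0G0 : F 0%N = G 0%N.
  rewrite /F /G expcoef0 rmorph1 ser_prod0E big1 // => j _.
  by rewrite ser_prod0E big1.
have reg m : GRing.lreg (m.+1%:R : {mpoly algC[N]}).
  by apply: mulfI; rewrite -mpolyC_nat mpolyC_eq0 pnatr_eq0.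
rewrite -[LHS]/(F n) (eqtrunc_sD reg sDF sDG A0 F0G0 AB) // /G.
have h0 : (\prod_i geo (x i)) 0%N = 1 by rewrite ser_prod0E big1.
(* The factor of [G] belonging to [y_j] is the series with coefficients [y_j^k h_k(x)]; grouping by
   exponents gives the products [m_l(y) h_l(x)]. *)
rewrite ser_prodE; under eq_bigr do under eq_bigr do rewrite prod_geo_scale.
rewrite (sum_mono_mul z h0); apply: eq_bigr => l _.
rewrite -mul_mpolyC rmorph_mono; congr (_ * _).
rewrite /sym_h_part rmorph_prod; apply: eq_bigr => k _.
rewrite sym_hE rmorph_prod_geo; congr (_ k).
by apply: eq_bigr => i _; rewrite /= map_X.
Qed.

Lemma map_qalg_inj N : injective (map_mpoly qalg : {mpoly rat[N]} -> {mpoly algC[N]}).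
Proof.
move=> p q E; apply/mpolyP => m; apply: (fmorph_inj qalg).
by rewrite -!mcoeff_map_mpoly E.
Qed.

Lemma half_tan_euler' k : (0 < k)%N -> (2 * k)`!%:R * half_tan k = euler' (2 * k).
Proof.
case: k => // k _; rewrite /half_tan /euler' mul2n doubleK -mul2n.
have -> : (2 * k.+1 = (2 * k).+2)%N by lia.
rewrite euler_odd factS natrM; have -> : (2 * k).+2%:R = 2 * k.+1%:R :> rat.
  by rewrite -natrM; congr _%:R; lia.
by field.
Qed.

Lemma h_coefficients n : (0 < n)%N ->
  exists cv : intpart -> rat,
   [/\ forall N, expcoef (p_weight N) n =
         \sum_(l <- partitions n) cv l *: sym_h_part l N,
       cv (mkpart (nseq n 1%N)) = (2 * n)`!%:R^-1,
       \sum_(l <- partitions n) cv l = sec2 n,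
       cv (mkpart [:: n]) = half_tan n
     & forall i j, (0 < i)%N -> (0 < j)%N -> (i + j)%N = n ->
         (if i == j then 2 else 1)%:R * cv (mkpart [:: i; j]) =
         half_tan i * half_tan j - half_tan n].
Proof.
move=> n0; have cos0 : qser cos2 0%N = 1.
  by rewrite /qser /cos2 muln0 fact0 expr0 divr1 rmorph1.
have [yt [y_cos ye]] := prod_lin_roots n cos0; set y := tnth yt in y_cos ye.
(* Here [e_k(y) = (-1)^k cos2 k = 1 / (2 k)!] is rational, so [cv l] can be chosen as the rational
   value of [m_l(y)]. *)
have /mono_rat/choice[cv cvE] : forall k, (k <= n)%N ->
    (mesym n algC k).@[y] = qalg ((-1) ^+ k * cos2 k).
  by move=> k kn; rewrite ye // rmorphM rmorphXn rmorphN rmorph1.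
have inj : injective qalg := fmorph_inj _.
exists cv; split => [N||||i j i0 j0 ijn].
- apply: map_qalg_inj; rewrite (expcoef_mono N y_cos) rmorph_sum.
  by apply: eq_bigr => l _; rewrite /= map_mpolyZ cvE.
- apply: inj; rewrite -cvE mono_nseq1 //.
  have := ye n (leqnn n); rewrite mesymnnE rmorph_prod /=.
  under eq_bigr do rewrite mevalXU; move=> ->.
  by rewrite /qser /cos2 rmorphM rmorph_sign signrMK.
- apply: inj; rewrite rmorph_sum /=; under eq_bigr do rewrite -cvE.
  by rewrite sum_mono (prod_geo_roots y_cos).
- by apply: inj; rewrite -cvE mono1 // (power_sum_roots y_cos) // n0 /=.
apply: inj; rewrite rmorphM rmorph_nat /= -cvE (mono2 _ i0 j0 ijn) rmorphB rmorphM /=.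
by rewrite !(power_sum_roots y_cos) ?n0 ?i0 ?j0 //= -ijn ?leq_addr ?leq_addl.
Qed.

Theorem theorem5p2 (n : nat) (n_ge1 : (1 <= n)%N) :
  exists c : {fsfun intpart -> rat with 0},
    [/\ unique (h_expansion (scale_symfun (2 * n)`!%:R (symA n))) c,
        c (mkpart (nseq n 1%N)) = 1,
        \sum_(l <- finsupp c) c l = euler (2 * n),
        c (mkpart [:: n]) = n%:R * euler (2 * n - 1) /\
          n%:R * euler (2 * n - 1) =
            #|[set w : 'S_(2 * n) | cyc_alternating w]|%:R
      & forall i j : nat, (1 <= i)%N -> (1 <= j)%N -> (i + j = n)%N ->
          (i <> j ->
             c (mkpart [:: i; j]) =
               'C(2 * n, 2 * i)%:R * euler' (2 * i) * euler' (2 * j)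
                 - euler' (2 * n)) /\
          (i = j ->
             c (mkpart [:: i; j]) =
               2^-1 * ('C(2 * n, n)%:R * euler' n ^+ 2 - euler' (2 * n)))].
Proof.
have [cv [cv_exp cv1 cv_sum cvn cv2]] := h_coefficients n_ge1.
pose c : {fsfun intpart -> rat with 0} :=
  [fsfun l in seq_fset tt (partitions n) => (2 * n)`!%:R * cv l].
have cE (l : intpart) : sumn l = n -> c l = (2 * n)`!%:R * cv l.
  by move=> ln; rewrite fsfunE seq_fsetE mem_partitions ln eqxx.
have sub : {subset finsupp c <= partitions n}.
  move=> l; rewrite mem_finsupp fsfunE seq_fsetE.
  by case: ifP => //; rewrite eqxx.
have euler_odd' : n%:R * euler (2 * n - 1) = euler' (2 * n).
  by rewrite /euler' mul2n doubleK subn1.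
have c_exp : h_expansion (scale_symfun (2 * n)`!%:R (symA n)) c.
  move=> N; rewrite scaled_symA cv_exp (big_finsupp _ (uniq_partitions n) sub).
  rewrite scaler_sumr !big_seq; apply: eq_bigr => l.
  by rewrite mem_partitions scalerA => /eqP /cE ->.
exists c; split.
- by split=> // c'; apply: h_expansion_inj.
- by rewrite cE ?cv1 ?divff ?fact_neq0 // sumn_mkpart sumn_nseq mul1n.
(* The sum of the coefficients is a linear combination in [rat^o] with all vectors equal to 1. *)
- have := @big_finsupp rat^o c _ (fun=> 1) (uniq_partitions n) sub.
  under eq_bigr do rewrite -[_ *: _]/(_ * 1) mulr1.
  move=> ->; rewrite euler_even -cv_sum mulr_sumr !big_seq; apply: eq_bigr => l.
  by rewrite mem_partitions => /eqP /cE ->; rewrite -[_ *: _]/(_ * 1) mulr1.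
- split; last exact: card_cyc_alternating.
  by rewrite cE ?sumn_mkpart //= ?addn0 // cvn half_tan_euler'.
move=> i j i0 j0 ijn; rewrite cE ?sumn_mkpart /= ?addn0 //.
have cvij := cv2 i j i0 j0 ijn.
have prodE : (2 * n)`!%:R * (half_tan i * half_tan j) =
    'C(2 * n, 2 * i)%:R * euler' (2 * i) * euler' (2 * j).
  rewrite -!half_tan_euler' //.
  have -> : (2 * n)`! = ('C(2 * n, 2 * i) * ((2 * i)`! * (2 * j)`!))%N.
    rewrite -(@bin_fact (2 * n) (2 * i)); last by lia.
    by have -> : (2 * n - 2 * i = 2 * j)%N by lia.
  by rewrite !natrM; ring.
split=> [/eqP ij|ij].
  rewrite (negbTE ij) mul1r in cvij.
  by rewrite cvij mulrBr prodE half_tan_euler'.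
(* As [n = 2 i], the coefficient ['C(2 * n, 2 * i)] is the central one; the factor 2 in [cvij]
   accounts for the half. *)
have n2 : n = (2 * i)%N by lia.
rewrite -ij in cvij prodE *; rewrite eqxx in cvij.
rewrite -n2 in prodE.
have -> : cv (mkpart [:: i; i]) = 2^-1 * (half_tan i * half_tan i - half_tan n).
  by rewrite -cvij mulrA mulVf ?mul1r.
by rewrite mulrCA mulrBr prodE half_tan_euler' // expr2 mulrA.
Qed.
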